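(* Let $\mathbb{K}$ be an algebraically closed field of arbitrary characteristic, and let $r,s,d,k$ be integers with $0\le s\le r-2$ and $d>k\ge0$. Let $p_1,\dots,p_n\in\mathbb{P}^1$ and $x_1,\dots,x_n\in X_{r,s}$ be general points. Consider the property of the existence of a map $f\colon\mathbb{P}^1\to X_{r,s}$ of degree $(d,k)$ satisfying $f(p_i)=x_i$ for all $i=1,\dots,n$. Then the largest value of $n$ for which this property holds is $$n_{\max}=\min\left(\left\lfloor\frac{(r-s)(d-k)}{r-s-1}\right\rfloor,\ \left\lfloor\frac{(r+1)d-(r-s-1)k}{r}\right\rfloor\right)+1.$$
   Context: $X_{r,s}=\mathrm{Bl}_{\mathbb{P}^s}(\mathbb{P}^r)$ is the blow-up of $\mathbb{P}^r$ (over $\mathbb{K}$) along a linear subspace $\mathbb{P}^s$. A map $f\colon\mathbb{P}^1\to X_{r,s}$ has degree $(d,k)$ if the hyperplane class pulled back from $\mathbb{P}^r$ has degree $d$ and the exceptional divisor has degree $k$ on $\mathbb{P}^1$. The two fractions are the slopes (degree divided by rank) $\mu(f^*\pi^*T_{\mathbb{P}^{r-s-1}})$ and $\mu(f^*T_{X_{r,s}})$, where $\pi\colon X_{r,s}\to\mathbb{P}^{r-s-1}$ resolves linear projection from $\mathbb{P}^s$. *)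

(* Defs.v *)
(* K is algebraically closed in the theorem, so varieties are given by their
   K-points. *)
From HB Require Import structures.
From mathcomp Require Import all_boot all_order all_algebra.
From mathcomp Require Import mpoly.
Set Implicit Arguments.
Unset Strict Implicit.
Unset Printing Implicit Defensive.
Import GRing.Theory.
Local Open Scope ring_scope.

(* Points of P^m are handled through nonzero vectors of homogeneous coordinates;
   two of them denote the same point when they satisfy [same_point]. *)
Record projpt (K : fieldType) (m : nat) := ProjPt {
  pcoord :> 'rV[K]_m.+1;
  pcoord_neq0 : pcoord != 0 }.

Definition same_point (K : fieldType) (m : nat) (u v : projpt K m) : Prop :=
  exists2 c : K, c != 0 & pcoord u = c *: pcoord v.

(* P^s in P^r is the subspace x_{s+1} = ... = x_r = 0; the i-th of these last
   r - s coordinates has index [tail r s i].  ([inord] never truncates here,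
   as soon as s < r.) *)
Definition tail (r s : nat) (i : 'I_(r - s - 1).+1) : 'I_r.+1 :=
  inord (s.+1 + i).

(* X_{r,s} is the closed subvariety of P^r x P^{r-s-1} given by the 2x2 minors
   of (x_{s+1}, ..., x_r ; y_0, ..., y_{r-s-1}), i.e. the closure of the graph of
   the linear projection from P^s. *)
Definition incident (K : fieldType) (r s : nat)
    (x : projpt K r) (y : projpt K (r - s - 1)) : Prop :=
  forall i j : 'I_(r - s - 1).+1,
    pcoord x 0 (tail i) * pcoord y 0 j = pcoord x 0 (tail j) * pcoord y 0 i.

Record blowup (K : fieldType) (r s : nat) := BlowupPt {
  blowdown : projpt K r;
  proj : projpt K (r - s - 1);
  blowup_incident : incident blowdown proj }.

Definition same_blowup_point (K : fieldType) (r s : nat)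
    (a b : blowup K r s) : Prop :=
  same_point (blowdown a) (blowdown b) /\ same_point (proj a) (proj b).

Definition in_exceptional (K : fieldType) (r s : nat) (a : blowup K r s) : Prop :=
  forall i : 'I_(r - s - 1).+1, pcoord (blowdown a) 0 (tail i) = 0.

(* A morphism P^1 -> P^m pulling O(1) back to O(e): m+1 binary forms of degree e
   without common zero. *)
Record p1map (K : fieldType) (m e : nat) := P1Map {
  form : 'I_m.+1 -> {mpoly K[2]};
  form_homog : forall i, form i \is e.-homog;
  form_bpf : forall v : projpt K 1, exists i, (form i).@[pcoord v 0] != 0 }.

Lemma p1map_neq0 (K : fieldType) (m e : nat) (f : p1map K m e) (v : projpt K 1) :
  (\row_i (form f i).@[pcoord v 0]) != 0.
Proof.
have [i nz] := form_bpf f v; apply: contraNneq nz => /rowP /(_ i).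
by rewrite !mxE => ->.
Qed.

Definition p1eval (K : fieldType) (m e : nat) (f : p1map K m e) (v : projpt K 1) :
  projpt K m := ProjPt (p1map_neq0 f v).

(* A morphism f : P^1 -> X_{r,s}, as a morphism to P^r x P^{r-s-1} landing in
   X_{r,s}.  [hyperplane_degree] is the degree of the hyperplane class pulled
   back from P^r and [base_degree] that of the one pulled back from
   P^{r-s-1}. *)
Record blowup_map (K : fieldType) (r s : nat) := BlowupMap {
  hyperplane_degree : nat;
  base_degree : nat;
  to_Pr : p1map K r hyperplane_degree;
  to_base : p1map K (r - s - 1) base_degree;
  map_incident : forall v : projpt K 1,
    incident (p1eval to_Pr v) (p1eval to_base v) }.

Definition blowup_eval (K : fieldType) (r s : nat) (f : blowup_map K r s)
    (v : projpt K 1) : blowup K r s := BlowupPt (map_incident f v).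

(* On X_{r,s} one has x_{s+1+i} = t y_i for a section t of O(1,-1) that cuts out
   the exceptional divisor E; hence O(E) = O(1,-1), whose pullback by f has the
   degree below, also when the image of f lies in E.  See [exceptional_degreeP]
   for the identification with the degree of the divisor f^*E otherwise. *)
Definition exceptional_degree (K : fieldType) (r s : nat) (f : blowup_map K r s) : int :=
  (hyperplane_degree f)%:Z - (base_degree f)%:Z.

Definition has_degree (K : fieldType) (r s : nat) (f : blowup_map K r s)
    (d k : nat) : Prop :=
  hyperplane_degree f = d /\ exceptional_degree f = k%:Z.

(* Homogeneous coordinates on (P^1)^n x (P^r x P^{r-s-1})^n, and the factor
   (numbered 0, 1, 2 for P^1, P^r, P^{r-s-1}) to which each belongs. *)
Definition coord (r s n : nat) : finType :=
  ('I_n * ('I_2 + ('I_r.+1 + 'I_(r - s - 1).+1)))%type.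

Definition factor (r s n : nat) (c : coord r s n) : 'I_n * 'I_3 :=
  (c.1, match c.2 with
        | inl _ => inord 0
        | inr (inl _) => inord 1
        | inr (inr _) => inord 2
        end).

Definition coord_val (K : fieldType) (r s n : nat)
    (p : 'I_n -> projpt K 1) (x : 'I_n -> blowup K r s) (c : coord r s n) : K :=
  match c.2 with
  | inl a => pcoord (p c.1) 0 a
  | inr (inl b) => pcoord (blowdown (x c.1)) 0 b
  | inr (inr b) => pcoord (proj (x c.1)) 0 b
  end.

Definition multihomogeneous (K : fieldType) (r s n : nat)
    (Q : {mpoly K[#|coord r s n|]}) : Prop :=
  exists e : 'I_n * 'I_3 -> nat,
    forall m, m \in msupp Q ->
    forall b, (\sum_(c : coord r s n | factor c == b) m (enum_rank c))%N = e b.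

Definition config_eval (K : fieldType) (r s n : nat)
    (Q : {mpoly K[#|coord r s n|]})
    (p : 'I_n -> projpt K 1) (x : 'I_n -> blowup K r s) : K :=
  Q.@[fun j => coord_val p x (enum_val j)].

(* P holds for general p_1, ..., p_n in P^1 and x_1, ..., x_n in X_{r,s}: it holds
   on a nonempty Zariski open subset of (P^1)^n x X_{r,s}^n.  This variety is
   irreducible (so nonempty open subsets are dense), and the loci Q <> 0 form a
   base of its topology. *)
Definition for_general_points (K : fieldType) (r s n : nat)
    (P : ('I_n -> projpt K 1) -> ('I_n -> blowup K r s) -> Prop) : Prop :=
  exists Q : {mpoly K[#|coord r s n|]},
    [/\ multihomogeneous Q,
        exists p x, config_eval Q p x != 0
      & forall p x, config_eval Q p x != 0 -> P p x].

Definition interpolation (K : fieldType) (r s d k n : nat) : Prop :=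
  @for_general_points K r s n (fun p x =>
    exists f : blowup_map K r s,
      has_degree f d k /\
      forall i : 'I_n, same_blowup_point (blowup_eval f (p i)) (x i)).

Definition is_largest (P : nat -> Prop) (N : nat) : Prop :=
  P N /\ forall n, P n -> (n <= N)%N.

Section ExceptionalDegree.
Variables (K : closedFieldType).
Implicit Types (p : {mpoly K[2]}) (d a : nat).

Let dehom_var (i : 'I_2) : {poly K} := if i == 0 then 'X else 1.
Let dehom p : {poly K} := mmap (@polyC K) dehom_var p.
Let mon (a b : nat) : 'X_{1..2} := [multinom (if i == 0%R then a else b) | i < 2].

Let mdeg2 (m : 'X_{1..2}) : mdeg m = (m 0%R + m 1%R)%N.
Proof. by rewrite mdegE big_ord_recl big_ord1; congr (_ + m _)%N; apply: val_inj. Qed.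

Let mon_eq (m : 'X_{1..2}) a b : (m == mon a b) = (m 0%R == a) && (m 1%R == b).
Proof.
apply/eqP/andP => [->|[/eqP ea /eqP eb]]; first by rewrite !mnmE.
apply/mnmP => i; rewrite mnmE -ea -eb.
by case: i => [[|[|//]] hi] /=; congr (m _); apply: val_inj.
Qed.

Let dehom_mon (m : 'X_{1..2}) : mmap1 dehom_var m = 'X^(m 0%R).
Proof. by rewrite /mmap1 big_ord_recl big_ord1 /dehom_var /= expr1n mulr1. Qed.

Let coef_dehom p a :
  (dehom p)`_a = \sum_(m <- msupp p) p@_m * (m 0%R == a)%:R.
Proof.
rewrite /dehom /mmap coef_sum; apply: eq_bigr => m _.
by rewrite dehom_mon coefCM coefXn eq_sym.
Qed.

Let mcoeff_sum p m0 : p@_m0 = \sum_(m <- msupp p) p@_m * (m == m0)%:R.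
Proof.
rewrite {1}[p]mpolyE (raddf_sum (mcoeff m0)); apply: eq_bigr => m _.
by rewrite /= mcoeffZ mcoeffX.
Qed.

Let coef_dehom_homog p d a : p \is d.-homog -> (a <= d)%N ->
  (dehom p)`_a = p@_(mon a (d - a)).
Proof.
move=> /dhomogP hp le_ad; rewrite coef_dehom mcoeff_sum.
apply: eq_big_seq => m /hp /= dm; congr (_ * _%:R); congr nat_of_bool.
rewrite mon_eq; case: eqP => //= e0; move: dm; rewrite mdeg2 e0 => <-.
by rewrite addKn eqxx.
Qed.

Let size_dehom p d : p \is d.-homog -> (size (dehom p) <= d.+1)%N.
Proof.
move=> /dhomogP hp; apply/leq_sizeP => a lt_da; rewrite coef_dehom.
rewrite big_seq big1 // => m /hp /= dm.
case: eqP => [e0|]; last by rewrite mulr0.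
by move: lt_da; rewrite -dm mdeg2 e0 ltnNge leq_addr.
Qed.

Let dehom_inj p q d : p \is d.-homog -> q \is d.-homog ->
  dehom p = dehom q -> p = q.
Proof.
move=> hp hq e; apply/mpolyP => m; have [dm|dm] := eqVneq (mdeg m) d; last first.
  by rewrite (dhomog_nemf_coeff hp dm) (dhomog_nemf_coeff hq dm).
have le_md : (m 0%R <= d)%N by rewrite -dm mdeg2 leq_addr.
have -> : m = mon (m 0%R) (d - m 0%R).
  by apply/eqP; rewrite mon_eq eqxx -dm mdeg2 addKn eqxx.
by rewrite -!(@coef_dehom_homog _ d) // e.
Qed.

Let dehomM : {morph dehom : p q / p * q}.
Proof. by move=> p q; rewrite /dehom rmorphM. Qed.

Let pt (a b : K) : 'rV[K]_2 := \row_i (if i == 0 then a else b).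

Let dehom_eval p t : (dehom p).[t] = p.@[pt t 1 0].
Proof.
rewrite mevalE /dehom /mmap horner_sum; apply: eq_bigr => m _.
rewrite dehom_mon hornerCM hornerXn; congr (_ * _).
by rewrite big_ord_recl big_ord1 !mxE /= expr1n mulr1.
Qed.

Let infty_eval p d : p \is d.-homog -> p.@[pt 1 0 0] = (dehom p)`_d.
Proof.
move=> /dhomogP hp; rewrite mevalE coef_dehom.
apply: eq_big_seq => m /hp /= dm; congr (_ * _).
rewrite big_ord_recl big_ord1 !mxE /= expr1n mul1r expr0n -dm mdeg2.
rewrite -[X in _ = (X == _)%:R]addn0 eqn_add2l eq_sym; congr (_ == _)%:R.
by congr (m _); apply: val_inj.
Qed.

Let pt_neq0 (a b : K) : (a != 0) || (b != 0) -> pt a b != 0.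
Proof.
apply: contraTneq => /rowP e; have := e 0; have := e 1; rewrite !mxE /=.
by move=> -> ->; rewrite eqxx.
Qed.

Let hom d (q : {poly K}) : {mpoly K[2]} :=
  \sum_(a < d.+1) q`_a *: 'X_[mon a (d - a)].

Let hom_homog d q : hom d q \is d.-homog.
Proof.
apply: rpred_sum => a _; apply: rpredZ; rewrite dhomogX /= mdeg2 !mnmE /=.
by rewrite subnKC // -ltnS.
Qed.

Let homK d (q : {poly K}) : (size q <= d.+1)%N -> dehom (hom d q) = q.
Proof.
move=> sq; rewrite -[RHS](coefK q) (poly_def) /dehom /hom raddf_sum /=.
rewrite (big_ord_widen _ (fun i => q`_i *: 'X^i) sq) [RHS]big_mkcond /=.
apply: eq_bigr => a _; rewrite mmapZ mmapX dehom_mon mnmE /= mul_polyC.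
by case: ltnP => // /(nth_default 0) ->; rewrite scale0r.
Qed.

(* If f(P^1) is not contained in E, the forms x_{s+1+i} o f, which cut out f^*E,
   are h times forms without common zero, where h has degree
   [exceptional_degree f]: thus f^*E is the divisor of h. *)
Lemma exceptional_degreeP (r s : nat) (f : blowup_map K r s) :
  (exists v, ~ in_exceptional (blowup_eval f v)) ->
  exists (k : nat) (h : {mpoly K[2]}),
    [/\ exceptional_degree f = k%:Z, h != 0, h \is k.-homog
      & forall i, form (to_Pr f) (tail i) = h * form (to_base f) i].
Proof.
case: f => d e F G inc [v0 /= nE].
pose phi (i : 'I_(r - s - 1).+1) := dehom (form F (tail i)); pose g i := dehom (form G i).
have phig i j : phi i * g j = phi j * g i.
  apply/eqP; rewrite -subr_eq0; apply/negPn/negP => /closed_nonrootP [t].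
  have ptn0 : pt t 1 != 0 by rewrite pt_neq0 ?oner_eq0 ?orbT.
  have := inc (ProjPt ptn0) i j; rewrite !mxE /= -!dehom_eval => e_ij.
  by rewrite rootE !hornerE e_ij subrr eqxx.
have [j0 gj0] : exists j, (g j)`_e != 0.
  have ptn0 : pt 1 0 != 0 by rewrite pt_neq0 ?oner_eq0.
  by have [j] := form_bpf G (ProjPt ptn0); rewrite /= (infty_eval (form_homog G j)); exists j.
have g0 : g j0 != 0 by apply: contraNneq gj0 => ->; rewrite coef0.
have sg : size (g j0) = e.+1.
  apply/eqP; rewrite eqn_leq size_dehom ?form_homog //=.
  by rewrite ltnNge; apply: contra gj0 => /leq_sizeP ->.
have dvd_gcd : g j0 %| phi j0 * \big[@gcdp K/0]_j g j.
  elim/big_ind: _ => [|p q hp hq|j _]; first by rewrite mulr0 dvdp0.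
    by rewrite (eqp_dvdr _ (mulp_gcdr _ _ _)) dvdp_gcd hp.
  by rewrite phig dvdp_mull.
have dvd_g : g j0 %| phi j0.
  suff : coprimep (g j0) (\big[@gcdp K/0]_j g j) by move=> /Gauss_dvdpl <-.
  have dvd_big i : \big[@gcdp K/0]_j g j %| g i.
    elim: (index_enum _) (mem_index_enum i) => //= j l IH.
    rewrite big_cons inE => /predU1P [->|il]; first exact: dvdp_gcdl.
    exact: dvdp_trans (dvdp_gcdr _ _) (IH il).
  rewrite coprimep_def; apply/negPn/negP => /closed_rootP [t].
  rewrite root_gcd => /andP [_ rt].
  have ptn0 : pt t 1 != 0 by rewrite pt_neq0 ?oner_eq0 ?orbT.
  have [i] := form_bpf G (ProjPt ptn0); rewrite /= -dehom_eval.
  by rewrite -/(g i); have /dvdpP [w ->] := dvd_big i; rewrite hornerM (rootP rt) mulr0 eqxx.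
pose q := phi j0 %/ g j0.
have phiE i : phi i = q * g i.
  apply: (mulIf g0); rewrite phig -mulrA [g i * _]mulrC mulrA.
  by rewrite /q divpK.
have q0 : q != 0.
  apply/eqP => qz; apply: nE => i /=; rewrite mxE.
  suff -> : form F (tail i) = 0 by rewrite meval0.
  apply: (@dehom_inj _ _ d); rewrite ?form_homog ?rpred0 //.
  by rewrite -/(phi i) phiE qz mul0r /dehom mmap0.
have szq : (size q + e <= d.+1)%N.
  have := size_dehom (form_homog F (tail j0)); rewrite -/(phi j0) phiE.
  by rewrite size_mul // sg addnS.
have le_ed : (e <= d)%N.
  by rewrite -ltnS (leq_trans _ szq) // -[X in (X < _)%N]add0n ltn_add2r size_poly_gt0.
have sq : (size q <= (d - e).+1)%N by rewrite -subSn // leq_subRL ?(leqW le_ed) // addnC.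
exists (d - e)%N, (hom (d - e) q); split.
- by rewrite /exceptional_degree /= subzn.
- by apply: contraNneq q0 => h0; rewrite -(homK sq) h0 /dehom mmap0.
- exact: hom_homog.
- move=> i; apply: (@dehom_inj _ _ d); first exact: form_homog.
    by rewrite -[X in X.-homog](subnK le_ed); apply: dhomogM; [exact: hom_homog|exact: form_homog].
  by rewrite dehomM homK // -phiE.
Qed.

End ExceptionalDegree.

(* Main.v *)
(* A map f is given by forms g of degree e = d - k to P^a, with a = r - s - 1,
   by a form h of degree k and by forms F of degree d, as f = (F, h g). A general
   point is x_i = ((u_i, t_i y_i), y_i), and f (p_i) = x_i amounts to
   y_i = beta_i g(p_i), u_i = beta_i lambda_i F(p_i), t_i = lambda_i h(p_i) with
   nonzero beta_i, lambda_i: for fixed p this is a polynomial map Phi from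
   (g, h, F, beta, lambda) to the configurations (y, u, t).

   Upper bound: after rescaling, beta and lambda are 1 at the first point. If
   there are then fewer parameters than coordinates (y, u, t), or fewer
   parameters (g, beta) than coordinates y, the coordinates satisfy a nontrivial
   polynomial relation, so that a general configuration is not reached.

   Existence: it is enough to find one point, possibly with base points, where
   the differential of Phi is surjective. By Lagrange interpolation its cokernel
   consists of polynomials q_j, Q_j, kappa of bounded degrees such that
   \sum_j q_j g_j = kappa h = - \sum_j Q_j F_j. With monomials g_j and F_j placed
   at opposite ends and h = (X - 1)^k, both inequalities on n force them to
   vanish. Hence Phi is dominant; by quantifier elimination its image contains a
   nonempty open set, also when p varies and base points are forbidden. *)
Require Import Defs.
From HB Require Import structures.
From mathcomp Require Import all_boot all_order all_algebra.
From mathcomp Require Import perm closed_field.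
From mathcomp Require Import mpoly.
From mathcomp Require Import zify ring.

Set Implicit Arguments.
Unset Strict Implicit.
Unset Printing Implicit Defensive.
Import GRing.Theory.

(** * Polynomial functions over an algebraically closed field *)

Section PolynomialFunctions.
Local Open Scope ring_scope.
Variable K : closedFieldType.

(** Polynomial functions in variables indexed by any type, with no ordering of the variables.
    [PolyExt] is a constructor because functions that agree pointwise are not identified. *)
Inductive polyfun (T : Type) : ((T -> K) -> K) -> Prop :=
| PolyConst c : polyfun (fun=> c)
| PolyVar t : polyfun (fun v => v t)
| PolyAdd f g : polyfun f -> polyfun g -> polyfun (fun v => f v + g v)
| PolyMul f g : polyfun f -> polyfun g -> polyfun (fun v => f v * g v)
| PolyExt f g : polyfun f -> f =1 g -> polyfun g.

Lemma polyfun_eq T (f : (T -> K) -> K) v w : polyfun f -> v =1 w -> f v = f w.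
Proof.
move=> pf vw; elim: pf => [||f1 f2 _ -> _ ->|f1 f2 _ -> _ ->|f1 f2 _ IH e12] //.
by rewrite -!e12.
Qed.

Lemma polyfun_sum T I (r : seq I) (P : pred I) (F : I -> (T -> K) -> K) :
  (forall i, polyfun (F i)) -> polyfun (fun v => \sum_(i <- r | P i) F i v).
Proof.
move=> pF; elim: r => [|i r IH].
  by apply: PolyExt (PolyConst _ 0) _ => v; rewrite big_nil.
have [Pi|nPi] := boolP (P i).
  by apply: PolyExt (PolyAdd (pF i) IH) _ => v; rewrite big_cons Pi.
by apply: PolyExt IH _ => v; rewrite big_cons (negPf nPi).
Qed.

Lemma polyfun_prod T I (r : seq I) (P : pred I) (F : I -> (T -> K) -> K) :
  (forall i, polyfun (F i)) -> polyfun (fun v => \prod_(i <- r | P i) F i v).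
Proof.
move=> pF; elim: r => [|i r IH].
  by apply: PolyExt (PolyConst _ 1) _ => v; rewrite big_nil.
have [Pi|nPi] := boolP (P i).
  by apply: PolyExt (PolyMul (pF i) IH) _ => v; rewrite big_cons Pi.
by apply: PolyExt IH _ => v; rewrite big_cons (negPf nPi).
Qed.

Lemma polyfun_exp T (f : (T -> K) -> K) m :
  polyfun f -> polyfun (fun v => f v ^+ m).
Proof.
move=> pf; apply: PolyExt (polyfun_prod (index_enum 'I_m) predT (fun=> pf)) _ => v.
by rewrite prodr_const card_ord.
Qed.

Lemma polyfun_sub T (f g : (T -> K) -> K) :
  polyfun f -> polyfun g -> polyfun (fun v => f v - g v).
Proof.
move=> pf pg; apply: PolyExt (PolyAdd pf (PolyMul (PolyConst _ (-1)) pg)) _ => v.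
by rewrite mulN1r.
Qed.

Lemma polyfun_det T m (A : 'I_m -> 'I_m -> (T -> K) -> K) :
  (forall i j, polyfun (A i j)) -> polyfun (fun v => \det (\matrix_(i, j) A i j v)).
Proof.
move=> pA.
have pf : polyfun (fun v => \sum_(s : 'S_m) (-1) ^+ s * \prod_i A i (s i) v).
  apply: polyfun_sum => s; apply: PolyMul (PolyConst _ _) _.
  by apply: polyfun_prod => i.
apply: PolyExt pf _ => v; apply: eq_bigr => s _; congr (_ * _).
by apply: eq_bigr => i _; rewrite mxE.
Qed.

Lemma polyfun_comp S T (f : (T -> K) -> K) (g : T -> (S -> K) -> K) :
  polyfun f -> (forall t, polyfun (g t)) -> polyfun (fun v => f (fun t => g t v)).
Proof.
move=> pf pg; elim: pf => [c|t|f1 f2 _ p1 _ p2|f1 f2 _ p1 _ p2|f1 f2 _ p1 e12].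
- exact: PolyConst.
- exact: pg.
- exact: PolyAdd.
- exact: PolyMul.
- by apply: PolyExt p1 _ => v; rewrite e12.
Qed.

Lemma polyfun_curve T (f : (T -> K) -> K) (q : T -> {poly K}) :
  polyfun f -> exists p : {poly K}, forall c, p.[c] = f (fun t => (q t).[c]).
Proof.
elim=> [c|t|f1 f2 _ [p1 e1] _ [p2 e2]|f1 f2 _ [p1 e1] _ [p2 e2]|f1 f2 _ [p1 e1] e12].
- by exists c%:P => x; rewrite hornerC.
- by exists (q t).
- by exists (p1 + p2) => x; rewrite hornerD e1 e2.
- by exists (p1 * p2) => x; rewrite hornerM e1 e2.
- by exists p1 => x; rewrite e1 e12.
Qed.

Lemma poly_vanishing_off0 (p : {poly K}) : (forall c, c != 0 -> p.[c] = 0) -> p = 0.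
Proof.
move=> p0; apply/eqP/negPn/negP => np.
have : 'X * p != 0 by rewrite mulf_neq0 ?polyX_eq0.
case/closed_nonrootP=> c; rewrite rootE hornerM hornerX mulf_eq0 negb_or.
by case/andP=> /p0 ->; rewrite eqxx.
Qed.

(** Irreducibility of affine space: on the line through [v] and [w] both functions become nonzero
    polynomials in one variable, whose product has a nonroot. *)
Lemma polyfun_common_nonzero T (f g : (T -> K) -> K) v w :
    polyfun f -> polyfun g -> f v != 0 -> g w != 0 ->
  exists u, f u != 0 /\ g u != 0.
Proof.
move=> pf pg fv gw.
pose q t : {poly K} := (v t)%:P + 'X * (w t - v t)%:P.
have [p1 e1] := polyfun_curve q pf; have [p2 e2] := polyfun_curve q pg.
have p1n0 : p1 != 0.
  apply: contraNneq fv => p10; have := e1 0; rewrite p10 horner0 => ->.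
  by apply/eqP/polyfun_eq => // t; rewrite !hornerE ?mul0r ?addr0.
have p2n0 : p2 != 0.
  apply: contraNneq gw => p20; have := e2 1; rewrite p20 horner0 => ->.
  apply/eqP/polyfun_eq => // t.
  by rewrite /q hornerD hornerM hornerX !hornerC mul1r addrC subrK.
have /closed_nonrootP [c] : p1 * p2 != 0 by rewrite mulf_neq0.
rewrite rootE hornerM mulf_eq0 negb_or e1 e2 => /andP[].
by exists (fun t => (q t).[c]).
Qed.

Lemma polyfun_prod_nonzero T (I : finType) (F : I -> (T -> K) -> K) :
    (forall i, polyfun (F i)) -> (forall i, exists v, F i v != 0) ->
  exists v, \prod_i F i v != 0.
Proof.
move=> pF nF; elim: (index_enum I) => [|i r [v IH]].
  by exists (fun=> 0); rewrite big_nil oner_eq0.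
have [w Fw] := nF i.
have [u [u1 u2]] := polyfun_common_nonzero (pF i) (polyfun_prod r predT pF) Fw IH.
by exists u; rewrite big_cons mulf_neq0.
Qed.

Lemma polyfun_mpoly (T : finType) (f : (T -> K) -> K) :
  polyfun f -> exists P : {mpoly K[#|T|]}, forall v, f v = P.@[fun j => v (enum_val j)].
Proof.
elim=> [c|t|f1 f2 _ [p1 e1] _ [p2 e2]|f1 f2 _ [p1 e1] _ [p2 e2]|f1 f2 _ [p1 e1] e12].
- by exists c%:MP => v; rewrite mevalC.
- by exists 'X_(enum_rank t) => v; rewrite mevalXU enum_rankK.
- by exists (p1 + p2) => v; rewrite mevalD e1 e2.
- by exists (p1 * p2) => v; rewrite mevalM e1 e2.
- by exists p1 => v; rewrite -e12 e1.
Qed.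

Lemma mpoly_polyfun n (P : {mpoly K[n]}) : polyfun (fun v => P.@[v]).
Proof.
have pf : polyfun (fun v : 'I_n -> K => \sum_(m <- msupp P) P@_m * \prod_i v i ^+ m i).
  apply: polyfun_sum => m; apply: PolyMul (PolyConst _ _) _.
  by apply: polyfun_prod => i; apply/polyfun_exp/PolyVar.
by apply: PolyExt pf _ => v; rewrite mevalE.
Qed.

Lemma digits_inj B n (f g : nat -> nat) :
    (forall i, f i < B)%N -> (forall i, g i < B)%N ->
    (\sum_(i < n) f i * B ^ i = \sum_(i < n) g i * B ^ i)%N ->
  forall i, (i < n)%N -> f i = g i.
Proof.
elim: n f g => [//|n IH] f g fB gB.
have B0 : (0 < B)%N by apply: leq_trans (fB 0%N).
have shift (h : nat -> nat) : (\sum_(i < n.+1) h i * B ^ i = (\sum_(i < n) h i.+1 * B ^ i) * B + h 0)%N.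
  rewrite big_ord_recl muln1 addnC big_distrl; congr (_ + _)%N.
  by apply: eq_bigr => i _; rewrite lift0 expnSr mulnA.
rewrite !shift => e.
have e0 : f 0%N = g 0%N.
  by have := congr1 (modn^~ B) e; rewrite /= !modnMDl !modn_small.
have eS : (\sum_(i < n) f i.+1 * B ^ i = \sum_(i < n) g i.+1 * B ^ i)%N.
  have := congr1 (divn^~ B) e; rewrite /= !divnMDl //.
  by rewrite !divn_small // !addn0.
by case=> [//|i] /(IH _ _ (fun i => fB i.+1) (fun i => gB i.+1) eS i).
Qed.

(* Kronecker substitution 'X_i -> 'X^(B ^ i), with B larger than all the
   exponents in P, keeps the monomials of P apart. *)
Lemma mpoly_nonroot n (P : {mpoly K[n]}) : P != 0 -> exists v, P.@[v] != 0.
Proof.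
move=> P0; pose B := (msize P).+1.
pose code (m : 'X_{1..n}) := (\sum_(i < n) m i * B ^ i)%N.
pose q : {poly K} := \sum_(m <- msupp P) P@_m *: 'X^(code m).
have code_inj : {in msupp P &, injective code}.
  move=> m1 m2 s1 s2 e; apply/mnmP => i.
  pose dig (m : 'X_{1..n}) j := if insub j is Some i then m i else 0%N.
  have digE m (l : 'I_n) : dig m l = m l by rewrite /dig valK.
  have digB m : m \in msupp P -> forall j, (dig m j < B)%N.
    move=> sm j; rewrite /dig; case: insubP => // l _ _.
    rewrite ltnS (leq_trans _ (ltnW (msize_mdeg_lt sm))) // mdegE.
    by rewrite (bigD1 l) //= leq_addr.
  rewrite -!digE; apply: (digits_inj (digB _ s1) (digB _ s2)) (ltn_ord i).
  by under eq_bigr do rewrite digE; under [RHS]eq_bigr do rewrite digE.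
have q0 : q != 0.
  have s0 : mlead P \in msupp P by rewrite mlead_supp.
  apply: contraTneq s0 => q0.
  rewrite mcoeff_msupp negbK; have := congr1 (fun p : {poly K} => p`_(code (mlead P))) q0.
  rewrite coef0 /q coef_sum (bigD1_seq (mlead P)) ?msupp_uniq ?mlead_supp //=.
  rewrite coefZ coefXn eqxx mulr1 big_seq_cond big1 ?addr0 => [->//|m /andP[sm nm]].
  rewrite coefZ coefXn; case: eqP => [/esym/code_inj e|]; last by rewrite mulr0.
  by rewrite e ?eqxx ?mlead_supp in nm.
have [c] := closed_nonrootP _ q0.
rewrite rootE => qc; exists (fun i : 'I_n => c ^+ (B ^ i)).
apply: contraNneq qc => e; apply/eqP; rewrite -[RHS]e mevalE /q horner_sum.
apply: eq_bigr => m _; rewrite hornerZ hornerXn; congr (_ * _).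
by rewrite /code expr_sum; apply: eq_bigr => i _; rewrite mulnC exprM.
Qed.

End PolynomialFunctions.

(** * Generic solvability by quantifier elimination *)

Section Elimination.
Local Open Scope ring_scope.
Variable K : closedFieldType.

(** The affine counterpart of [for_general_points]: [P] holds on a nonempty principal open set. *)
Definition polyfun_generic T (P : (T -> K) -> Prop) : Prop :=
  exists R : (T -> K) -> K,
    [/\ polyfun R, exists v, R v != 0 & forall v, R v != 0 -> P v].

Lemma term_polyfun T (e : (T -> K) -> seq K) (t : GRing.term K) :
  (forall i, polyfun (fun v => (e v)`_i)) -> GRing.rterm t ->
  polyfun (fun v => GRing.eval (e v) t).
Proof.
move=> pe; elim: t => //=.
- by move=> c _; apply: PolyConst.
- by move=> c _; apply: PolyConst.
- by move=> t1 IH1 t2 IH2 /andP[/IH1 ? /IH2 ?]; apply: PolyAdd.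
- move=> t IH /IH pt; apply: PolyExt (PolyMul (PolyConst _ (-1)) pt) _ => v.
  by rewrite mulN1r.
- move=> t IH m /IH pt; apply: PolyExt (PolyMul (PolyConst _ m%:R) pt) _ => v.
  by rewrite mulr_natl.
- by move=> t1 IH1 t2 IH2 /andP[/IH1 ? /IH2 ?]; apply: PolyMul.
- by move=> t IH m /IH ?; apply: polyfun_exp.
Qed.

Lemma polyfun_zero_dec (T : finType) (f : (T -> K) -> K) :
  polyfun f -> (forall v, f v = 0) \/ exists v, f v != 0.
Proof.
move=> /polyfun_mpoly [P eP]; have [P0|/mpoly_nonroot [v nv]] := eqVneq P 0.
  by left=> v; rewrite eP P0 meval0.
right; exists (fun t => v (enum_rank t)); rewrite eP.
by rewrite (meval_eq _ (v2 := v)) // => j; rewrite enum_valK.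
Qed.

(** A polynomial equation either holds identically or fails on a nonempty open set. Two such sets
    meet, so every Boolean combination has a constant truth value on some nonempty open set. *)
Lemma qf_eval_generic (T : finType) (e : (T -> K) -> seq K) (f : GRing.formula K) :
    (forall i, polyfun (fun v => (e v)`_i)) ->
    GRing.qf_form f && GRing.rformula f ->
  exists b, polyfun_generic (fun v => GRing.qf_eval (e v) f = b).
Proof.
move=> pe.
have bin (op : bool -> bool -> bool) (g1 g2 : (T -> K) -> bool) :
    (exists b, polyfun_generic (fun v => g1 v = b)) ->
    (exists b, polyfun_generic (fun v => g2 v = b)) ->
  exists b, polyfun_generic (fun v => op (g1 v) (g2 v) = b).
  move=> [b1 [R1 [p1 [v1 n1] h1]]] [b2 [R2 [p2 [v2 n2] h2]]].
  exists (op b1 b2), (fun v => R1 v * R2 v); split; first exact: PolyMul.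
    have [u [u1 u2]] := polyfun_common_nonzero p1 p2 n1 n2.
    by exists u; rewrite mulf_neq0.
  by move=> v; rewrite mulf_eq0 negb_or => /andP[/h1 -> /h2 ->].
have triv b : polyfun_generic (fun _ : T -> K => b = b).
  by exists (fun=> 1); split; [exact: PolyConst | exists (fun=> 0); rewrite oner_eq0|].
elim: f => //=.
- by move=> b _; exists b; apply: triv.
- move=> t1 t2 /andP[r1 r2].
  have pd := polyfun_sub (term_polyfun pe r1) (term_polyfun pe r2).
  have [d0|[v nv]] := polyfun_zero_dec pd.
    exists true; have [R [pR nR _]] := triv true; exists R; split=> // v _.
    by rewrite -subr_eq0 d0 eqxx.
  exists false; exists (fun v => GRing.eval (e v) t1 - GRing.eval (e v) t2).
  by split=> // [|w]; [exists v | rewrite subr_eq0 => /negPf].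
- by move=> f1 IH1 f2 IH2; rewrite andbACA => /andP[/IH1 h1 /IH2 h2]; apply: bin.
- by move=> f1 IH1 f2 IH2; rewrite andbACA => /andP[/IH1 h1 /IH2 h2]; apply: bin.
- by move=> f1 IH1 f2 IH2; rewrite andbACA => /andP[/IH1 h1 /IH2 h2]; apply: bin.
(* Negation is passed as a binary operation that ignores its second argument. *)
- by move=> f1 IH1 /IH1 h1; exact: (bin (fun b _ => ~~ b) _ _ h1 h1).
Qed.

Definition join (T X : Type) (v : T -> K) (x : X -> K) (c : T + X) : K :=
  match c with inl t => v t | inr y => x y end.

Definition joint_env (T X : finType) (v : T -> K) (x : X -> K) : seq K :=
  [seq join v x c | c <- enum {: T + X}].

Lemma nth_joint_env (T X : finType) (v : T -> K) (x : X -> K) c :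
  (joint_env v x)`_(enum_rank c) = join v x c.
Proof.
rewrite /joint_env (nth_map c) ?nth_enum_rank //.
by rewrite -cardE.
Qed.

Lemma polyfun_term (S : finType) (f : (S -> K) -> K) : polyfun f ->
  exists2 t : GRing.term K, GRing.rterm t
    & forall e : seq K, GRing.eval e t = f (fun c => e`_(enum_rank c)).
Proof.
elim=> [c|t|f1 f2 _ [t1 r1 e1] _ [t2 r2 e2]|f1 f2 _ [t1 r1 e1] _ [t2 r2 e2]|].
- by exists (GRing.Const c).
- by exists (GRing.Var _ (enum_rank t)).
- by exists (GRing.Add t1 t2) => [|e] /=; rewrite ?r1 // e1 e2.
- by exists (GRing.Mul t1 t2) => [|e] /=; rewrite ?r1 // e1 e2.
- by move=> f1 f2 _ [t1 r1 e1] e12; exists t1 => // e; rewrite e1 e12.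
Qed.

(** Eliminating the quantifiers over [x] makes [S] a Boolean combination of polynomial equations in
    [v], to which [qf_eval_generic] applies. This is what later upgrades a dense set of solvable
    data to one containing an open set. *)
Lemma solvable_generic_or_not (T X J : finType)
    (E : J -> (T + X -> K) -> K) (D : (T + X -> K) -> K)
    (S := fun v => exists x, (forall j, E j (join v x) = 0) /\ D (join v x) != 0) :
    (forall j, polyfun (E j)) -> polyfun D ->
  polyfun_generic S \/ polyfun_generic (fun v => ~ S v).
Proof.
move=> pE pD.
have [tD rD eD] := polyfun_term pD.
have /fin_all_exists [tE htE] j : exists t : GRing.term K, GRing.rterm t /\
    forall e : seq K, GRing.eval e t = E j (fun c => e`_(enum_rank c)).
  by have [t r e] := polyfun_term (pE j); exists t.
pose f0 := foldr GRing.And (GRing.Not (GRing.Equal tD (GRing.Const 0)))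
  [seq GRing.Equal (tE j) (GRing.Const 0) | j <- enum J].
have f0P e : GRing.holds e f0 <-> (forall j, E j (fun c => e`_(enum_rank c)) = 0) /\
    D (fun c => e`_(enum_rank c)) != 0.
  suff {}f0P (s : seq J) : GRing.holds e (foldr GRing.And (GRing.Not (GRing.Equal tD (GRing.Const 0)))
     [seq GRing.Equal (tE j) (GRing.Const 0) | j <- s]) <->
     (forall j, j \in s -> E j (fun c => e`_(enum_rank c)) = 0) /\
    D (fun c => e`_(enum_rank c)) != 0.
    split=> [/f0P [h1 h2]|[h1 h2]]; first by split=> // j; apply: h1; rewrite mem_enum.
    by apply/f0P; split=> // j _; apply: h1.
  elim: s => [|j s IH] /=.
    by rewrite eD; split=> [/eqP h|[_ /eqP h]].
  rewrite (htE j).2; split=> [[e0 /IH [h1 h2]]|[h1 h2]].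
    by split=> // i; rewrite inE => /predU1P[->//|/h1].
  split; first by apply: h1; rewrite mem_head.
  by apply/IH; split=> // i si; apply: h1; rewrite inE si orbT.
have rf0 : GRing.rformula f0.
  rewrite /f0; elim: (enum J) => [|j s IH] /=; first by rewrite rD.
  by rewrite (htE j).1.
pose I : seq nat := [seq (enum_rank (inr x : T + X) : nat) | x <- enum X].
pose f1 := foldr GRing.Exists f0 I.
have rf1 : GRing.rformula f1 by rewrite /f1; elim: (I).
(* The unknowns are bound by the quantifiers of [f1], so any value can stand for them here. *)
pose e (v : T -> K) := joint_env v (fun _ : X => 0).
have SP v : S v <-> GRing.holds (e v) f1.
  rewrite /f1 -GRing.foldExistsP; split=> [[x Sx]|[e' se he']].
    exists (joint_env v x).
      move=> i; rewrite !inE => ni.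
      have [lti|gei] := ltnP i #|{: T + X}|; last first.
        by rewrite !nth_default // size_map -cardE.
      have -> : i = enum_rank (enum_val (Ordinal lti)) by rewrite enum_valK.
      rewrite !nth_joint_env; move: ni; case Ec: (enum_val _) => [t|y] //.
      case/negP; apply/mapP; exists y; rewrite ?mem_enum //.
      by rewrite -Ec enum_valK.
    apply/f0P; case: Sx => h1 h2; split=> [j|].
      by rewrite -[RHS](h1 j); apply: polyfun_eq => // c; rewrite nth_joint_env.
    rewrite (polyfun_eq (w := join v x)) // => c; by rewrite nth_joint_env.
  have ee' c : e'`_(enum_rank c) = join v (fun x => e'`_(enum_rank (inr x : T + X))) c.
    case: c => [t|//]; rewrite -se ?nth_joint_env //.
    rewrite inE; apply/mapP => -[x _] /ord_inj /enum_rank_inj.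
    by [].
  exists (fun x => e'`_(enum_rank (inr x : T + X))); case/f0P: he' => h1 h2.
  split=> [j|]; first by rewrite -[RHS](h1 j); apply: polyfun_eq => // c.
  by rewrite -(polyfun_eq pD ee').
pose g := GRing.quantifier_elim (@ClosedFieldQE.ex_elim K) f1.
have wf := @ClosedFieldQE.wf_ex_elim K.
have ok := ClosedFieldQE.holds_ex_elim (@GRing.solve_monicpoly K).
have gP v : reflect (GRing.holds (e v) f1) (GRing.qf_eval (e v) g).
  exact: GRing.quantifier_elim_rformP.
have pe i : polyfun (fun v => (e v)`_i).
  have [lti|gei] := ltnP i #|{: T + X}|; last first.
    apply: (PolyExt (PolyConst T (0 : K))) => v.
    by rewrite nth_default // size_map -cardE.
  have -> : i = enum_rank (enum_val (Ordinal lti)) by rewrite enum_valK.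
  case Ec: (enum_val _) => [t|y].
    by apply: (PolyExt (@PolyVar K T t)) => v; rewrite nth_joint_env.
  by apply: (PolyExt (PolyConst T (0 : K))) => v; rewrite nth_joint_env.
have [[] [R [pR nR hR]]] := qf_eval_generic pe (GRing.quantifier_elim_wf wf rf1).
  by left; exists R; split=> // v /hR /gP /SP.
by right; exists R; split=> // v /hR h /SP /gP; rewrite h.
Qed.

End Elimination.

(** * Dominance and algebraic dependence *)

Section Dominance.
Local Open Scope ring_scope.
Variable K : closedFieldType.

(** If only [eta = 0] annihilates the image, the transposed matrix has trivial kernel, so the matrix
    of [L] has full rank. *)
Lemma surjective_of_trivial_cokernel (X W : finType) (L : (X -> K) -> W -> K) :
    (forall x y, x =1 y -> L x =1 L y) ->
    (forall c x y w, L (fun t => c * x t + y t) w = c * L x w + L y w) ->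
    (forall eta : W -> K, (forall x, \sum_w eta w * L x w = 0) -> forall w, eta w = 0) ->
  forall z, exists x, forall w, L x w = z w.
Proof.
move=> Lext Llin coker z.
pose f (u : 'rV[K]_#|X|) : 'rV[K]_#|W| :=
  \row_j L (fun t => u 0 (enum_rank t)) (enum_val j).
have flin : linear f.
  move=> c u v; apply/rowP => j; rewrite !mxE -Llin; apply: Lext => t.
  by rewrite !mxE.
pose fL : {linear 'rV[K]_#|X| -> 'rV[K]_#|W|} :=
  HB.pack f (GRing.isLinear.Build _ _ _ _ f flin).
pose M := lin1_mx fL.
have ME u : u *m M = f u by rewrite mul_rV_lin1.
have full : row_full M.
  rewrite /row_full -mxrank_tr -[_ == _]/(row_free M^T) -kermx_eq0; apply/eqP/row_matrixP => i.
  rewrite row0; set v := row i _.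
  have vM : M *m v^T = 0.
    apply: trmx_inj; rewrite trmx_mul trmxK trmx0.
    by apply/sub_kermxP; rewrite row_sub.
  apply/rowP => j; rewrite [RHS]mxE -[j]enum_valK.
  apply: (coker (fun w => v 0 (enum_rank w))) => x.
  have := congr1 (fun A : 'M_(1, 1) => A 0 0) (mulmxA (\row_t x (enum_val t)) M v^T).
  rewrite vM mulmx0 ME !mxE => /esym eL; rewrite -[RHS]eL.
  rewrite [LHS](reindex _ (onW_bij _ (enum_val_bij W))) /=.
  apply: eq_bigr => l _; rewrite !mxE mulrC enum_valK; congr (_ * _).
  by apply: Lext => t; rewrite mxE enum_rankK.
have /submxP [u zu] := submx_full (\row_j z (enum_val j)) full.
exists (fun t => u 0 (enum_rank t)) => w.
have := congr1 (fun A : 'rV_#|W| => A 0 (enum_rank w)) zu.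
by rewrite ME !mxE enum_rankK.
Qed.

(** The coefficient of index [d] of [q v] is the homogeneous component of degree [d] of [f],
    evaluated at [v]. The uniform bound on sizes says that there are finitely many components. *)
Lemma polyfun_ray (T : Type) (f : (T -> K) -> K) : polyfun f ->
  exists q : (T -> K) -> {poly K},
    [/\ forall d, polyfun (fun v => (q v)`_d),
        forall v x, (q v).[x] = f (fun t => x * v t)
      & exists D, forall v, (size (q v) <= D)%N].
Proof.
elim=> [c|t|f1 f2 _ [q1 [p1 e1 [D1 s1]]] _ [q2 [p2 e2 [D2 s2]]]
  |f1 f2 _ [q1 [p1 e1 [D1 s1]]] _ [q2 [p2 e2 [D2 s2]]]|f1 f2 _ [q [p e s]] e12].
- exists (fun=> c%:P); split=> [d|v x|]; first exact: PolyConst.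
    by rewrite hornerC.
  by exists 1%N => v; apply: size_polyC_leq1.
- exists (fun v => v t *: 'X); split=> [d|v x|].
  + apply: PolyExt (PolyMul (@PolyVar K T t) (PolyConst T (d == 1%N)%:R)) _ => v.
    by rewrite coefZ coefX.
  + by rewrite hornerZ hornerX mulrC.
  + by exists 2%N => v; rewrite (leq_trans (size_scale_leq _ _)) ?size_polyX.
- exists (fun v => q1 v + q2 v); split=> [d|v x|].
  + by apply: PolyExt (PolyAdd (p1 d) (p2 d)) _ => v; rewrite coefD.
  + by rewrite hornerD e1 e2.
  + exists (maxn D1 D2) => v; rewrite (leq_trans (size_polyD _ _)) //.
    by rewrite geq_max !leq_max s1 s2 orbT.
- exists (fun v => q1 v * q2 v); split=> [d|v x|].
  + have pf : polyfun (fun v => \sum_(j < d.+1) (q1 v)`_j * (q2 v)`_(d - j)).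
      by apply: polyfun_sum => j; apply: PolyMul.
    by apply: PolyExt pf _ => v; rewrite coefM.
  + by rewrite hornerM e1 e2.
  + exists (D1 + D2)%N => v; rewrite (leq_trans (size_polyMleq _ _)) //.
    by rewrite (leq_trans (leq_pred _)) // leq_add.
- by exists q; split=> // v x; rewrite e e12.
Qed.

(* The lowest order part of R at Phi x0, composed with the differential of Phi
   at x0, is the lowest order part of R o Phi; no derivative of R is taken,
   so that the characteristic of K plays no role. *)
Lemma dominant_of_surjective_differential (X W : finType)
    (Phi : (X -> K) -> W -> K) (x0 : X -> K) (R : (W -> K) -> K) :
    (forall z : W -> K, exists (x : X -> K) (q : W -> {poly K}), forall w c,
       Phi (fun t => x0 t + c * x t) w = Phi x0 w + c * z w + c ^+ 2 * (q w).[c]) ->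
    polyfun R -> (forall x, R (Phi x) = 0) ->
  forall v, R v = 0.
Proof.
move=> smooth pR R0; pose f z := R (fun w => Phi x0 w + z w).
have pf : polyfun f.
  by apply: polyfun_comp => // w; exact: (PolyAdd (PolyConst W (Phi x0 w)) (@PolyVar K W w)).
have [q [pq eq [D sq]]] := polyfun_ray pf.
(* All homogeneous components of [f] are shown to vanish, by strong induction on their degree. *)
suff q0 d z : (q z)`_d = 0.
  move=> v; have := eq (fun w => v w - Phi x0 w) 1.
  have -> : q (fun w => v w - Phi x0 w) = 0 by apply/polyP => d; rewrite coef0 q0.
  rewrite horner0 => ->; apply: polyfun_eq => // w.
  by rewrite mul1r addrC subrK.
elim/ltn_ind: d z => d IH z.
have [dD|Dd] := ltnP d D; last by rewrite nth_default // (leq_trans (sq _)).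
have [x [r er]] := smooth z.
(* Along the chosen curve [Phi] equals [Phi x0 + c * zeta.[c]], and [zeta] takes the value [z] at
   0. *)
pose zeta w : {poly K} := (z w)%:P + 'X * r w.
have [s es] : exists s : nat -> {poly K}, forall i c,
    (s i).[c] = (q (fun w => (zeta w).[c]))`_i.
  have [s hs] : exists s : 'I_D -> {poly K}, forall i c,
      (s i).[c] = (q (fun w => (zeta w).[c]))`_i.
    have H (i : 'I_D) := polyfun_curve zeta (pq i).
    by have [s hs] := fin_all_exists H; exists s.
  exists (fun i => if insub i is Some j then s j else 0) => i c.
  case: insubP => [j _ <-|]; first exact: hs.
  by rewrite -leqNgt => Di; rewrite horner0 nth_default // (leq_trans (sq _)).
have eval0 c : \sum_(i < D) (s i).[c] * c ^+ i = 0.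
  rewrite -[RHS](R0 (fun t => x0 t + c * x t)).
  transitivity ((q (fun w => (zeta w).[c])).[c]).
    rewrite (horner_coef_wide _ (sq _)); apply: eq_bigr => i _; by rewrite es.
  rewrite eq; apply: (polyfun_eq pR) => w; rewrite er /zeta.
  by rewrite hornerD hornerM hornerX hornerC mulrDr mulrA -expr2 addrA.
(* The components of degree below [d] vanish by induction, so [eval0] can be divided by [c ^+ d].
   What remains is [p], and [p.[0]] is the component of degree [d] at [z]. *)
pose p : {poly K} := \sum_(i < D | (d <= i)%N) s i * 'X^(i - d).
have p0 : p = 0.
  apply: poly_vanishing_off0 => c nc; apply: (mulfI (expf_neq0 d nc)).
  rewrite mulr0 -[RHS](eval0 c) /p horner_sum mulr_sumr.
  rewrite [RHS](bigID (fun i : 'I_D => (d <= i)%N)) /=.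
  rewrite [X in _ + X]big1 ?addr0 => [|i]; last first.
    by rewrite -ltnNge es => di; rewrite IH // mul0r.
  apply: eq_bigr => i di; rewrite hornerM hornerXn mulrCA -exprD.
  by rewrite subnKC.
have := congr1 (fun p : {poly K} => p.[0]) p0; rewrite horner0 /p horner_sum /=.
rewrite (bigD1 (Ordinal dD)) //= big1 ?addr0 => [|i /andP[di ne]].
  rewrite subnn mulr1 es => h; rewrite -[RHS]h.
  by apply: (polyfun_eq (pq d)) => w; rewrite /zeta hornerD hornerM hornerX hornerC mul0r addr0.
rewrite hornerM hornerXn expr0n subn_eq0 -[(i <= d)%N]negbK -ltnNge.
by rewrite ltn_neqAle di eq_sym andbT ne mulr0.
Qed.

End Dominance.

Section Counting.
Local Open Scope ring_scope.
Variable K : closedFieldType.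

(** Degrees add up over at most [D * #|I|] factors; the successors appear because [msize] is the
    degree plus one. *)
Lemma msize_prod_exp n (I : finType) (P : I -> {mpoly K[n]}) (Delta D : nat)
    (alpha : I -> 'I_D.+1) : (forall i, msize (P i) <= Delta.+1)%N ->
  (msize (\prod_i P i ^+ alpha i) <= (D * #|I| * Delta).+1)%N.
Proof.
move=> hP.
have mulB (p q : {mpoly K[n]}) a b :
    (msize p <= a.+1)%N -> (msize q <= b.+1)%N -> (msize (p * q) <= (a + b).+1)%N.
  move=> ha hb; have [->|p0] := eqVneq p 0; first by rewrite mul0r msize0.
  have [->|q0] := eqVneq q 0; first by rewrite mulr0 msize0.
  rewrite msizeM // -subn1 leq_subLR (leq_trans (leq_add ha hb)) //.
  by rewrite addSn addnS add1n.
have expB (p : {mpoly K[n]}) a b : (msize p <= a.+1)%N -> (msize (p ^+ b) <= (b * a).+1)%N.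
  move=> ha; elim: b => [|b IH]; first by rewrite expr0 msize1.
  by rewrite exprS mulSn; apply: mulB.
have h (s : seq I) : (msize (\prod_(i <- s) P i ^+ alpha i) <= (D * size s * Delta).+1)%N.
  elim: s => [|i s IH]; first by rewrite big_nil msize1 muln0.
  rewrite big_cons /= mulnS mulnDl; apply: mulB => //.
  apply: leq_trans (expB _ _ _ (hP i)) _.
  by rewrite ltnS leq_mul2r -ltnS ltn_ord orbT.
by have := h (index_enum I); rewrite [size _](_ : _ = #|I|) // cardE [in RHS]enumT.
Qed.

(* There are (D+1)^M monomials in M unknowns with all exponents at most D;
   substituted in them, M polynomials in fewer unknowns span a space whose
   dimension is of lower order in D. *)
Lemma algebraic_dependence (X W : finType) (Phi : W -> (X -> K) -> K) :
    (#|X| < #|W|)%N -> (forall w, polyfun (Phi w)) ->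
  exists R : (W -> K) -> K,
    [/\ polyfun R, exists v, R v != 0 & forall x, R (fun w => Phi w x) = 0].
Proof.
move=> XW pPhi.
have [P eP] := fin_all_exists (fun w => polyfun_mpoly (pPhi w)).
pose Delta := \max_w msize (P w).
have PD w : (msize (P w) <= Delta.+1)%N by apply/leqW/leq_bigmax.
(* [B] bounds the degrees of the substituted monomials. With this [D], [(B + 1) ^ #|X| <= (D + 1) ^
   #|X| * D < (D + 1) ^ #|W|], so the matrix [A] has more rows than columns. *)
pose D := ((#|W| * Delta).+1 ^ #|X|)%N; pose B := (D * #|W| * Delta)%N.
(* The row of an exponent vector lists the coefficients of the corresponding monomial in the [P w].
   A vector in the left kernel is therefore a polynomial relation between the [P w]. *)
pose A : 'M[K]_(#|{ffun W -> 'I_D.+1}|, #|{ffun 'I_#|X| -> 'I_B.+1}|) :=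
  \matrix_(i, j) (\prod_w P w ^+ (enum_val i : {ffun W -> 'I_D.+1}) w)@_
    [multinom ((enum_val j : {ffun 'I_#|X| -> 'I_B.+1}) l : nat) | l < #|X|].
have nfree : ~~ row_free A.
  rewrite -row_leq_rank -ltnNge (leq_ltn_trans (rank_leq_col A)) //.
  rewrite !card_ffun !card_ord.
  apply: (@leq_ltn_trans (D.+1 ^ #|X| * D)).
    rewrite /D -expnMn -/D; case: #|X| => [|m]; first by rewrite !expn0.
    by rewrite leq_exp2r // /B -mulnA mulSn mulnS addSn ltnS addnA leq_addl.
  apply: (@leq_trans (D.+1 ^ #|X|.+1)); last by rewrite leq_exp2l // ltnS expn_gt0.
  by rewrite expnSr ltn_pmul2l // expn_gt0.
have /rowV0Pn [z /sub_kermxP zA z0] : kermx A != 0 by rewrite kermx_eq0.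
have [i0 zi0] : exists i, z 0 i != 0 by apply/rV0Pn.
pose R v := \sum_i z 0 i * \prod_w v w ^+ (enum_val i : {ffun W -> 'I_D.+1}) w.
exists R; split.
- apply: polyfun_sum => i; apply: PolyMul (PolyConst _ _) _.
  by apply: polyfun_prod => w; apply/polyfun_exp/PolyVar.
- pose mon (i : 'I_#|{ffun W -> 'I_D.+1}|) := [multinom ((enum_val i : {ffun W -> 'I_D.+1}) (enum_val j) : nat) | j < #|W|].
  have mon_inj : injective mon.
    move=> i j /mnmP e; apply/enum_val_inj/ffunP => w; apply/ord_inj.
    by have := e (enum_rank w); rewrite !mnmE enum_rankK.
  have Q0 : \sum_i z 0 i *: 'X_[mon i] != 0 :> {mpoly K[#|W|]}.
    apply: contraNneq zi0 => /(congr1 (mcoeff (mon i0))).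
    rewrite mcoeff0 raddf_sum (bigD1 i0) //= mcoeffZ mcoeffX eqxx mulr1 big1 ?addr0 => [->//|i ni].
    by rewrite mcoeffZ mcoeffX (inj_eq mon_inj) (negPf ni) mulr0.
  have [v nv] := mpoly_nonroot Q0; exists (fun w => v (enum_rank w)).
  apply: contraNneq nv => <-; rewrite raddf_sum /=; apply/eqP/eq_bigr => i _.
  rewrite mevalZ mevalX; congr (_ * _); rewrite [RHS](reindex _ (onW_bij _ (enum_val_bij W))).
  by apply: eq_bigr => j _; rewrite mnmE enum_valK.
move=> x; suff Q0 : \sum_i z 0 i *: \prod_w P w ^+ (enum_val i : {ffun W -> 'I_D.+1}) w = 0.
  have := congr1 (meval (fun j => x (enum_val j))) Q0; rewrite meval0 => <-.
  rewrite raddf_sum; apply: eq_bigr => i _; rewrite /= mevalZ rmorph_prod; congr (_ * _).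
  by apply: eq_bigr => w _; rewrite rmorphXn eP.
apply/mpolyP => m; rewrite mcoeff0 raddf_sum /=.
have [mB|Bm] := leqP (mdeg m) B; last first.
  rewrite big1 // => i _; rewrite mcoeffZ memN_msupp_eq0 ?mulr0 //.
  by apply: msize_mdeg_ge; apply: leq_trans Bm; apply: msize_prod_exp.
pose gam : {ffun 'I_#|X| -> 'I_B.+1} := [ffun l => inord (m l)].
have := congr1 (fun A : 'rV_#|{ffun 'I_#|X| -> 'I_B.+1}| => A 0 (enum_rank gam)) zA.
rewrite !mxE => e; rewrite -[RHS]e; apply: eq_bigr => i _; rewrite mcoeffZ !mxE; congr (_ * _@_ _).
apply/mnmP => l; rewrite mnmE enum_rankK ffunE inordK // ltnS (leq_trans _ mB) //.
by rewrite mdegE (bigD1 l) //= leq_addr.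
Qed.

End Counting.

(** * Interpolation at distinct points *)

Section Lagrange.
Local Open Scope ring_scope.
Variables (K : fieldType) (n : nat) (P : 'I_n -> K).

Let lagr (i : 'I_n) : {poly K} := \prod_(j | j != i) ('X - (P j)%:P).

Lemma size_lagr i : size (lagr i) = n.
Proof.
rewrite size_prod => [|j _]; last by rewrite polyXsubC_eq0.
under eq_bigr do rewrite size_XsubC.
rewrite sum_nat_const cardC1 card_ord.
by case: n i => [[]//|m] i /=; lia.
Qed.

(* The coefficients of q are linear combinations of the power sums
   \sum_i eta i * P i ^+ l, as in the expansion at infinity of the partial
   fraction \sum_i eta i / ('X - P i). *)
Lemma moment_interpolation (eta : 'I_n -> K) m :
    (forall l, (l <= m)%N -> \sum_i eta i * P i ^+ l = 0) ->
  exists2 q : {poly K}, (size q <= n - m.+1)%N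
    & forall i, q.[P i] = eta i * \prod_(j | j != i) (P i - P j).
Proof.
move=> mom; pose q l := \sum_i (eta i * P i ^+ l) *: lagr i.
(* Since [P i *: lagr i = 'X * lagr i - Pi], passing from [q l] to [q l.+1] multiplies by ['X] and
   subtracts the moment of order [l] times [Pi]. While moments vanish, coefficients are merely
   shifted, and the bound on the size of [q m.+1] then bounds that of [q 0]. *)
have step l t : (l <= m)%N -> (q l)`_t = (q l.+1)`_t.+1.
  move=> lm; rewrite !coef_sum.
  pose Pi := \prod_j ('X - (P j)%:P).
  have -> : \sum_i ((eta i * P i ^+ l) *: lagr i)`_t =
      (\sum_i eta i * P i ^+ l) * Pi`_t.+1 + \sum_i ((eta i * P i ^+ l.+1) *: lagr i)`_t.+1.
    rewrite mulr_suml -big_split; apply: eq_bigr => i _ /=.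
    have -> : Pi = lagr i * 'X - (P i) *: lagr i.
      by rewrite /Pi (bigD1 i) //= mulrBl mulrC mul_polyC.
    rewrite !coefZ coefB coefMX coefZ /= exprSr mulrBr !mulrA subrK //.
  by rewrite mom // mul0r add0r.
have stepn l t : (l <= m.+1)%N -> (q 0)`_t = (q l)`_(t + l).
  elim: l => [|l IH] lm; first by rewrite addn0.
  by rewrite IH ?(ltnW lm) // step // addnS.
exists (q 0).
  apply/leq_sizeP => t nt; rewrite (stepn m.+1) //.
  rewrite nth_default // (leq_trans (size_sum _ _ _)) //.
  apply/bigmax_leqP => i _; rewrite (leq_trans (size_scale_leq _ _)) // size_lagr.
  by move: nt; lia.
move=> i; rewrite /q horner_sum (bigD1 i) //= big1 ?addr0 => [|j ji].
  rewrite expr0 mulr1 hornerZ /lagr horner_prod; congr (_ * _).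
  by apply: eq_bigr => j _; rewrite hornerXsubC.
rewrite hornerZ /lagr horner_prod (bigD1 i) 1?eq_sym //=.
by rewrite hornerXsubC subrr mul0r mulr0.
Qed.

Lemma poly_vanishing_at (q : {poly K}) :
  injective P -> (size q <= n)%N -> (forall i, q.[P i] = 0) -> q = 0.
Proof.
move=> Pinj sq q0; apply: (@roots_geq_poly_eq0 _ q [seq P i | i <- enum 'I_n]).
- by apply/allP => _ /mapP [i _ ->]; rewrite rootE q0.
- by rewrite map_inj_uniq ?enum_uniq.
- by rewrite size_map -cardE card_ord.
Qed.

End Lagrange.

(** The exponents of the [j]-th summand lie in [[j * N, (j + 1) * N)], so distinct summands cannot
    cancel. *)
Lemma block_sum_eq0 (K : fieldType) m N (q : 'I_m -> {poly K}) :
    (forall j, size (q j) <= N) ->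
    (\sum_j q j * 'X^(j * N) = 0 -> forall j, q j = 0)%R.
Proof.
move=> sq e j0; apply/polyP => x; rewrite coef0.
have [Nx|xN] := leqP N x; first by rewrite nth_default // (leq_trans (sq _)).
have := congr1 (fun p : {poly K} => nth 0%R p (j0 * N + x)) e.
rewrite coef0 coef_sum (bigD1 j0) //= coefMXn ltnNge leq_addr /= addKn.
rewrite big1 ?GRing.addr0 // => j jj0; rewrite coefMXn.
have [//|le_jN] := ltnP (j0 * N + x) (j * N).
rewrite nth_default // (leq_trans (sq _)) //.
have lt_jj0 : j < j0.
  rewrite ltn_neqAle jj0 leqNgt; apply/negP => ltj.
  by have := leq_mul2r N j0.+1 j; rewrite ltj orbT mulSn; lia.
by have := leq_mul2r N j.+1 j0; rewrite lt_jj0 orbT mulSn; lia.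
Qed.

(** * Maps to the blow-up and their interpolation data *)

Section Parametrization.
Local Open Scope ring_scope.
Variables (K : closedFieldType) (a s e d k n : nat).

Definition params : finType :=
  (('I_a.+1 * 'I_e.+1) + ('I_k.+1 + (('I_s.+1 * 'I_d.+1) + ('I_n + 'I_n))))%type.

Definition targets : finType := ('I_n * ('I_a.+1 + ('I_s.+1 + unit)))%type.

Definition form_val m (c : 'I_m.+1 -> K) (v : 'I_2 -> K) : K :=
  \sum_l c l * (v 0 ^+ l * v 1 ^+ (m - l)).

Definition gco (x : params -> K) j l := x (inl (j, l)).
Definition hco (x : params -> K) l := x (inr (inl l)).
Definition fco (x : params -> K) j l := x (inr (inr (inl (j, l)))).
Definition bet (x : params -> K) i := x (inr (inr (inr (inl i)))).
Definition lam (x : params -> K) i := x (inr (inr (inr (inr i)))).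

(* A map has forms (F, h g) to P^r and g to P^a. A point of the blow-up off the
   exceptional divisor is ((u, t y), y), and the values at p i of the forms
   represent it exactly when y, u, t are as below for some nonzero bet i, lam i. *)
Definition interp_data (p : 'I_n -> 'I_2 -> K) (x : params -> K) (w : targets) : K :=
  match w.2 with
  | inl j => bet x w.1 * form_val (gco x j) (p w.1)
  | inr (inl j) => bet x w.1 * lam x w.1 * form_val (fco x j) (p w.1)
  | inr (inr _) => lam x w.1 * form_val (hco x) (p w.1)
  end.

Lemma form_val_lin m (c1 c2 : 'I_m.+1 -> K) z v :
  form_val (fun l => c1 l + z * c2 l) v = form_val c1 v + z * form_val c2 v.
Proof.
rewrite /form_val mulr_sumr -big_split; apply: eq_bigr => l _ /=.
by rewrite mulrDl -[_ * _ * (_ * _)]mulrA.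
Qed.

Lemma eq_form_val m (c1 c2 : 'I_m.+1 -> K) (v1 v2 : 'I_2 -> K) :
  c1 =1 c2 -> v1 =1 v2 -> form_val c1 v1 = form_val c2 v2.
Proof. by move=> e1 e2; apply: eq_bigr => l _; rewrite e1 !e2. Qed.

(** The differential of [interp_data] at [x0] in the direction [x], in the case where all [bet x0 i]
    and [lam x0 i] are 1. *)
Definition tangent (p : 'I_n -> 'I_2 -> K) (x0 x : params -> K) (w : targets) : K :=
  match w.2 with
  | inl j => form_val (gco x j) (p w.1) + bet x w.1 * form_val (gco x0 j) (p w.1)
  | inr (inl j) => form_val (fco x j) (p w.1) +
      (bet x w.1 + lam x w.1) * form_val (fco x0 j) (p w.1)
  | inr (inr _) => form_val (hco x) (p w.1) + lam x w.1 * form_val (hco x0) (p w.1)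
  end.

(** For fixed [p] the data have degree at most three in the parameters, so the remainder after the
    linear term is explicit. This is the form of differentiability that
    [dominant_of_surjective_differential] asks for. *)
Lemma interp_data_expand p x0 x :
    (forall i, bet x0 i = 1) -> (forall i, lam x0 i = 1) ->
  exists q : targets -> {poly K}, forall w c,
    interp_data p (fun t => x0 t + c * x t) w =
    interp_data p x0 w + c * tangent p x0 x w + c ^+ 2 * (q w).[c].
Proof.
move=> b1 l1.
pose q (w : targets) : {poly K} := match w.2 with
  | inl j => (bet x w.1 * form_val (gco x j) (p w.1))%:P
  | inr (inl j) => (bet x w.1 * lam x w.1 * form_val (fco x0 j) (p w.1) +
        (bet x w.1 + lam x w.1) * form_val (fco x j) (p w.1))%:P +
      'X * (bet x w.1 * lam x w.1 * form_val (fco x j) (p w.1))%:P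
  | inr (inr _) => (lam x w.1 * form_val (hco x) (p w.1))%:P
  end.
exists q; case=> i [j|[j|[]]] c; rewrite /interp_data /tangent /q /=
  ?hornerD ?hornerM ?hornerX !hornerC.
- rewrite (form_val_lin (gco x0 j) (gco x j)) /bet.
  rewrite -/(bet x0 i) -/(bet x i) b1; ring.
- rewrite (form_val_lin (fco x0 j) (fco x j)) /bet /lam.
  rewrite -/(bet x0 i) -/(bet x i) -/(lam x0 i) -/(lam x i) b1 l1; ring.
- rewrite (form_val_lin (hco x0) (hco x)) /lam.
  rewrite -/(lam x0 i) -/(lam x i) l1; ring.
Qed.

Lemma polyfun_form_val T m (c : (T -> K) -> 'I_m.+1 -> K) (v : (T -> K) -> 'I_2 -> K) :
    (forall l, polyfun (c^~ l)) -> (forall l, polyfun (v^~ l)) ->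
  polyfun (fun z => form_val (c z) (v z)).
Proof.
move=> pc pv; apply: polyfun_sum => l; apply: PolyMul => //.
by apply: PolyMul; apply: polyfun_exp.
Qed.

Lemma polyfun_interp_data T (p : (T -> K) -> 'I_n -> 'I_2 -> K) (x : (T -> K) -> params -> K) w :
    (forall i l, polyfun (fun z => p z i l)) -> (forall c, polyfun (x^~ c)) ->
  polyfun (fun z => interp_data (p z) (x z) w).
Proof.
move=> pp px; case: w => i [j|[j|[]]]; rewrite /interp_data /=.
- by apply: PolyMul; [apply: px | apply: polyfun_form_val => l; [apply: px | apply: pp]].
- apply: PolyMul; first by apply: PolyMul; apply: px.
  by apply: polyfun_form_val => l; [apply: px | apply: pp].
- by apply: PolyMul; [apply: px | apply: polyfun_form_val => l; [apply: px | apply: pp]].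
Qed.

(** The point of the projective line with affine coordinate [P i], normalized to have last
    coordinate 1. *)
Definition affine (P : 'I_n -> K) i (t : 'I_2) : K := if t == 0 then P i else 1.

Lemma form_val_affine m (c : 'I_m.+1 -> K) P i :
  form_val c (affine P i) = \sum_l c l * P i ^+ l.
Proof. by apply: eq_bigr => l _; rewrite /affine /= expr1n mulr1. Qed.

Lemma form_val_poly m (q : {poly K}) P i : (size q <= m.+1)%N ->
  form_val (fun l : 'I_m.+1 => q`_l) (affine P i) = q.[P i].
Proof. by move=> sq; rewrite form_val_affine (horner_coef_wide _ sq). Qed.

(** [eta] is orthogonal to the image. The five conclusions come from varying, in this order, the
    coefficients of [g], [h], [F], then [beta] and [lambda]. *)
Lemma tangent_cokernel P (x0 : params -> K) (eta : targets -> K) :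
    (forall x, \sum_w eta w * tangent (affine P) x0 x w = 0) ->
  [/\ forall j l, (l <= e)%N -> \sum_i eta (i, inl j) * P i ^+ l = 0,
      forall l, (l <= k)%N -> \sum_i eta (i, inr (inr tt)) * P i ^+ l = 0,
      forall j l, (l <= d)%N -> \sum_i eta (i, inr (inl j)) * P i ^+ l = 0,
      forall i, \sum_j eta (i, inl j) * form_val (gco x0 j) (affine P i) +
                \sum_j eta (i, inr (inl j)) * form_val (fco x0 j) (affine P i) = 0
    & forall i, \sum_j eta (i, inr (inl j)) * form_val (fco x0 j) (affine P i) +
                eta (i, inr (inr tt)) * form_val (hco x0) (affine P i) = 0].
Proof.
move=> coker.
pose G (c : params) : K := match c with
  | inl (j, l) => \sum_i eta (i, inl j) * P i ^+ l
  | inr (inl l) => \sum_i eta (i, inr (inr tt)) * P i ^+ l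
  | inr (inr (inl (j, l))) => \sum_i eta (i, inr (inl j)) * P i ^+ l
  | inr (inr (inr (inl i))) =>
      \sum_j eta (i, inl j) * form_val (gco x0 j) (affine P i) +
      \sum_j eta (i, inr (inl j)) * form_val (fco x0 j) (affine P i)
  | inr (inr (inr (inr i))) =>
      \sum_j eta (i, inr (inl j)) * form_val (fco x0 j) (affine P i) +
                eta (i, inr (inr tt)) * form_val (hco x0) (affine P i)
  end.
suff expand x : \sum_w eta w * tangent (affine P) x0 x w = \sum_c x c * G c.
  have G0 c : G c = 0.
    have := coker (fun c' => (c' == c)%:R); rewrite expand (bigD1 c) //= eqxx mul1r.
    rewrite big1 ?addr0 // => c' /negPf ->; exact: mul0r.
  split=> [j l le|l lk|j l ld|i|i].
  - exact: (G0 (inl (j, Ordinal (le : (l < e.+1)%N)))).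
  - exact: (G0 (inr (inl (Ordinal (lk : (l < k.+1)%N))))).
  - exact: (G0 (inr (inr (inl (j, Ordinal (ld : (l < d.+1)%N)))))).
  - exact: (G0 (inr (inr (inr (inl i))))).
  - exact: (G0 (inr (inr (inr (inr i))))).
have swap m (c : 'I_m.+1 -> K) (y : 'I_n -> K) :
    \sum_i y i * form_val c (affine P i) = \sum_l c l * \sum_i y i * P i ^+ l.
  under eq_bigr do rewrite form_val_affine mulr_sumr.
  rewrite exchange_big; apply: eq_bigr => l _ /=; rewrite mulr_sumr.
  by apply: eq_bigr => i _; rewrite mulrCA.
have pairE (I J : finType) (F : I * J -> K) : \sum_p F p = \sum_i \sum_j F (i, j).
  by rewrite pair_bigA; apply: eq_bigr => -[].
transitivity (
   \sum_j \sum_i eta (i, inl j) * form_val (gco x j) (affine P i) +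
   (\sum_i eta (i, inr (inr tt)) * form_val (hco x) (affine P i) +
   (\sum_j \sum_i eta (i, inr (inl j)) * form_val (fco x j) (affine P i) +
   (\sum_i bet x i * G (inr (inr (inr (inl i)))) +
    \sum_i lam x i * G (inr (inr (inr (inr i)))))))).
  rewrite (exchange_big_dep predT) //= [X in _ + (_ + (X + _))](exchange_big_dep predT) //=.
  rewrite -!big_split pairE /=.
  apply: eq_bigr => i _; rewrite big_sumType big_sumType /=.
  rewrite (big_pred1 tt) => [|[]] //.
  rewrite /tangent /=.
  under eq_bigr do rewrite mulrDr mulrCA.
  rewrite big_split -mulr_sumr /=.
  under [X in _ + (X + _)]eq_bigr do rewrite mulrDr mulrCA.
  rewrite big_split -mulr_sumr /=; ring.
rewrite !big_sumType /= swap !pairE.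
congr (_ + (_ + (_ + _))).
  by apply: eq_bigr => j _; rewrite swap.
by apply: eq_bigr => j _; rewrite swap.
Qed.

End Parametrization.

(** * Surjectivity of the differential at a configuration of monomials *)

Section Deformation.
Local Open Scope ring_scope.
Variables (K : closedFieldType) (a s e d k m : nat).
Local Notation params := (params a s e d k m.+1).
Local Notation targets := (targets a s m.+1).

(* For g_j = 'X^(j N1), F_j = 'X^(B + j N2) and h = ('X - 1)^k, with N1, N2 and
   B as in the proof, a cokernel element of the tangent map gives polynomials with \sum_j q_j 'X^(j N1) = kappa ('X - 1)^k =
   - \sum_j Q_j 'X^(B + j N2), where q_j, Q_j have at most N1, N2 coefficients:
   the exponents of this polynomial lie in [B, (a + 1) N1), of length at most
   k, but it is divisible by ('X - 1)^k. *)
Lemma tangent_surjective (P : 'I_m.+1 -> K) :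
    injective P -> d = (e + k)%N -> (a * m <= a.+1 * e)%N ->
    ((a + s.+1) * m + a * k <= (a + s.+2) * d)%N ->
  exists x0 : params -> K,
    [/\ forall i, bet x0 i = 1, forall i, lam x0 i = 1
      & forall z, exists x, forall w, tangent (affine P) x0 x w = z w].
Proof.
move=> Pinj dE hA hB.
(* [N1] and [N2] are the size bounds that [moment_interpolation] gives for [q_j] and [Q_j] with
   [m + 1] points. Unless truncated, [B] makes the last of the [s + 1] blocks of length [N2] end at
   [m]. *)
pose N1 := (m - e)%N; pose N2 := (m - d)%N; pose B := (m - s.+1 * N2)%N.
have aN1 : (a * N1 <= e)%N by rewrite /N1 mulnBr leq_subLR; move: hA; rewrite mulSn addnC.
(* Either the [Q_j] have no coefficients at all, or no subtraction is truncated and the second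
   inequality amounts to [a.+1 * N1 <= k + B]. *)
have N2P : (N2 = 0 \/ [/\ (m = d + N2), N1 = N2 + k, s.+1 * N2 <= m & a.+1 * N1 <= k + B])%N.
  have [|lt_dm] := leqP m d; first by rewrite -subn_eq0 => /eqP; left.
  right; have mE : (m = d + N2)%N by rewrite /N2 subnKC // ltnW.
  have N1E : (N1 = N2 + k)%N by rewrite /N1 mE dE; lia.
  have h : (a * N2 + a * k + s.+1 * N2 <= d)%N by move: hB; rewrite mE; nia.
  have hs : (s.+1 * N2 <= m)%N by rewrite mE; lia.
  split=> //; rewrite N1E mulSn mulnDr /B.
  by move: h hs mE; set u := (s.+1 * N2)%N; lia.
have gE (j : 'I_a.+1) : (j * N1 <= e)%N.
  by apply: leq_trans aN1; rewrite leq_mul2r -ltnS ltn_ord orbT.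
have fE (j : 'I_s.+1) : (B + j * N2 <= d)%N.
  have lejs : (j * N2 <= s * N2)%N by rewrite leq_mul2r -ltnS ltn_ord orbT.
  case: N2P => [N20|[mE _ hs _]]; first by rewrite N20 muln0 addn0 /B N20 muln0 subn0 -subn_eq0 -/N2 N20.
  by move: hs lejs; rewrite /B mulSn; lia.
pose h : {poly K} := ('X - 1%:P) ^+ k.
have sh : size h = k.+1 by rewrite /h size_exp_XsubC.
pose x0 (c : params) : K := match c with
  | inl (j, l) => ('X^(j * N1))`_l
  | inr (inl l) => h`_l
  | inr (inr (inl (j, l))) => ('X^(B + j * N2))`_l
  | _ => 1
  end.
have gval j i : form_val (gco x0 j) (affine P i) = P i ^+ (j * N1).
  rewrite -[RHS]hornerXn -(@form_val_poly _ _ e) //.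
  by rewrite size_polyXn ltnS gE.
have fval j i : form_val (fco x0 j) (affine P i) = P i ^+ (B + j * N2).
  rewrite -[RHS]hornerXn -(@form_val_poly _ _ d) //.
  by rewrite size_polyXn ltnS fE.
have hval i : form_val (hco x0) (affine P i) = h.[P i].
  by rewrite -(@form_val_poly _ _ k) // sh.
exists x0; split=> //; apply: surjective_of_trivial_cokernel.
- move=> x y xy [i [j|[j|[]]]]; rewrite /tangent /=.
  + by congr (_ + _ * _); [apply: eq_form_val => // l|]; apply: xy.
  + by congr (_ + (_ + _) * _); [apply: eq_form_val => // l| |]; apply: xy.
  + by congr (_ + _ * _); [apply: eq_form_val => // l|]; apply: xy.
- have lin n (c1 c2 : 'I_n.+1 -> K) z v :
      form_val (fun l => z * c1 l + c2 l) v = z * form_val c1 v + form_val c2 v.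
    rewrite addrC -form_val_lin; apply: eq_form_val => // l; exact: addrC.
  move=> c x y [i [j|[j|[]]]]; rewrite /tangent /=.
  + rewrite (lin _ (gco x j) (gco y j)) /bet; ring.
  + rewrite (lin _ (fco x j) (fco y j)) /bet /lam; ring.
  + rewrite (lin _ (hco x) (hco y)) /lam; ring.
move=> eta /tangent_cokernel [m1 m2 m3 m4 m5].
(* The denominators of Lagrange interpolation, nonzero because the points are distinct. *)
pose Delta i := \prod_(j | j != i) (P i - P j).
have Delta0 i : Delta i != 0.
  apply/prodf_neq0 => j ji; rewrite subr_eq0; apply: contraNneq ji => /Pinj ->.
  exact: eqxx.
have /fin_all_exists [q hq] j : exists q : {poly K}, (size q <= N1)%N /\
    forall i, q.[P i] = eta (i, inl j) * Delta i.
  by have [q sq eq] := moment_interpolation (m1 j); exists q; rewrite subSS in sq.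
have /fin_all_exists [Q hQ] j : exists q : {poly K}, (size q <= N2)%N /\
    forall i, q.[P i] = eta (i, inr (inl j)) * Delta i.
  by have [q' sq eq] := moment_interpolation (m3 j); exists q'; rewrite subSS in sq.
have [kap skap ekap] := moment_interpolation m2.
rewrite subSS in skap.
pose A := \sum_j q j * 'X^(j * N1).
pose C := \sum_j Q j * 'X^(B + j * N2).
have sprod (p r : {poly K}) x y : (size p <= x)%N -> (size r <= y.+1)%N -> (x + y <= m.+1)%N ->
    (size (p * r)%R <= m.+1)%N.
  move=> sp sr xy; rewrite (leq_trans (size_polyMleq _ _)) //.
  by move: sp sr xy; lia.
have AE i : A.[P i] = Delta i * \sum_j eta (i, inl j) * form_val (gco x0 j) (affine P i).
  rewrite /A horner_sum mulr_sumr; apply: eq_bigr => j _.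
  by rewrite hornerM hornerXn (hq j).2 gval; ring.
have CE i : C.[P i] = Delta i * \sum_j eta (i, inr (inl j)) * form_val (fco x0 j) (affine P i).
  rewrite /C horner_sum mulr_sumr; apply: eq_bigr => j _.
  by rewrite hornerM hornerXn (hQ j).2 fval; ring.
(* When [m - y] is truncated to 0, the factor [p] is 0 and the bound still holds. *)
have zmulM (p r : {poly K}) x y : (size p <= x)%N -> (size r <= y.+1)%N -> (x = m - y)%N ->
    (size (p * r)%R <= m.+1)%N.
  move=> sp sr xy; have [lt_ym|le_my] := ltnP y m; first by apply: sprod sp sr _; lia.
  have -> : p = 0 by apply/eqP; rewrite -size_poly_eq0 -leqn0; apply: leq_trans sp _; lia.
  by rewrite mul0r size_poly0.
have sA : (size A <= m.+1)%N.
  rewrite (leq_trans (size_sum _ _ _)) //; apply/bigmax_leqP => j _.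
  by apply: zmulM (hq j).1 _ (erefl _); rewrite size_polyXn ltnS gE.
have sC : (size C <= m.+1)%N.
  rewrite (leq_trans (size_sum _ _ _)) //; apply/bigmax_leqP => j _.
  by apply: zmulM (hQ j).1 _ (erefl _); rewrite size_polyXn ltnS fE.
have sH : (size (kap * h)%R <= m.+1)%N by apply: zmulM skap _ (erefl _); rewrite sh.
(* A polynomial with at most [m + 1] coefficients that vanishes at [m + 1] points is 0; the values
   vanish by the [beta] equation, and for [CH] by the [lambda] equation. *)
have AC : A + C = 0.
  apply: (poly_vanishing_at Pinj) => [|i].
    by rewrite (leq_trans (size_polyD _ _)) // geq_max sA.
  by rewrite hornerD AE CE -mulrDr m4 mulr0.
have CH : C + kap * h = 0.
  apply: (poly_vanishing_at Pinj) => [|i].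
    by rewrite (leq_trans (size_polyD _ _)) // geq_max sC.
  by rewrite hornerD hornerM ekap CE -hval -/(Delta i) -[_ * Delta i * _]mulrAC [_ * Delta i]mulrC -mulrDr m5 mulr0.
have CXB : C = (\sum_j Q j * 'X^(j * N2)) * 'X^B.
  rewrite mulr_suml; apply: eq_bigr => j _.
  by rewrite -mulrA -exprD addnC.
have C0 : C = 0.
  case: N2P => [N20|[mE N1E hs hk]].
    rewrite /C big1 // => j _; have := (hQ j).1; rewrite N20 leqn0 size_poly_eq0.
    by move/eqP->; rewrite mul0r.
  have hC : (h %| C)%R.
    have -> : C = - (kap * h) by apply/eqP; rewrite -addr_eq0 CH.
    by rewrite dvdpNr dvdp_mull.
  set S := (\sum_j _) in CXB.
  have hS : (h %| S)%R.
    move: hC; rewrite CXB Gauss_dvdpl // coprimep_expl // coprimep_expr //.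
    have := coprimep_XsubC ('X - 1%:P) (0 : K).
    by rewrite polyC0 subr0 root_XsubC eq_sym oner_eq0.
  (* As [C = - A], its exponents are below [a.+1 * N1 <= k + B]; removing ['X^B] leaves fewer
     coefficients than [h] has, so that divisibility by [h] forces [S = 0]. *)
  have sS : (size S <= k)%N.
    have [->|S0] := eqVneq S 0; first by rewrite size_poly0.
    have szC : (size C <= a.+1 * N1)%N.
      have -> : C = - A by apply/eqP; rewrite -addr_eq0 addrC AC.
      rewrite size_polyN (leq_trans (size_sum _ _ _)) //; apply/bigmax_leqP => j _.
      rewrite (leq_trans (size_polyMleq _ _)) // size_polyXn addnS /=.
      have := leq_mul2r N1 j.+1 a.+1; rewrite ltn_ord orbT mulSn.
      by move=> /(leq_trans _); apply; rewrite leq_add2r (hq j).1.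
    by have := leq_trans szC hk; rewrite CXB size_mulXn // addnC leq_add2r.
  rewrite CXB; suff -> : S = 0 by rewrite mul0r.
  by apply/eqP/negPn/negP => /dvdp_leq /(_ hS); rewrite sh ltnNge sS.
have q0 : forall j, q j = 0.
  apply: (block_sum_eq0 (fun j => (hq j).1)).
  by move: AC; rewrite C0 addr0.
have Q0 : forall j, Q j = 0.
  apply: (block_sum_eq0 (fun j => (hQ j).1)).
  by move/eqP: C0; rewrite CXB mulf_eq0 expf_eq0 polyX_eq0 andbF orbF => /eqP.
have kap0 : kap = 0.
  move/eqP: CH; rewrite C0 add0r mulf_eq0 -[h == 0]size_poly_eq0 sh orbF.
  by move/eqP.
case=> i [j|[j|[]]]; apply: (mulIf (Delta0 i)); rewrite mul0r.
- by rewrite -(hq j).2 q0 horner0.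
- by rewrite -(hQ j).2 Q0 horner0.
- by rewrite -ekap kap0 horner0.
Qed.

End Deformation.

(** * Resultants of binary forms *)

Section Sylvester.
Local Open Scope ring_scope.
Variable K : closedFieldType.

(** The columns are the shifted coefficient vectors of the two forms, first [m1] shifts of [c2],
    then [m2] shifts of [c1]; the determinant is their resultant up to sign. *)
Definition sylvester m1 m2 (c1 : 'I_m1.+1 -> K) (c2 : 'I_m2.+1 -> K) : 'M[K]_(m1 + m2) :=
  \matrix_(x, i) match @split m1 m2 i with
    | inl y => \sum_l c2 l * ((x : nat) == (y + l)%N)%:R
    | inr y => \sum_l c1 l * ((x : nat) == (y + l)%N)%:R
    end.

(** At a common zero [v], the row of all monomials of degree [m1 + m2 - 1] evaluated at [v] is
    killed by the matrix, since each column pairs with it to a monomial times one of the forms. *)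
Lemma sylvester_no_common_zero m1 m2 (c1 : 'I_m1.+1 -> K) (c2 : 'I_m2.+1 -> K) v :
    (0 < m1 + m2)%N -> \det (sylvester c1 c2) != 0 -> (v 0 != 0) || (v 1 != 0) ->
  (form_val c1 v != 0) || (form_val c2 v != 0).
Proof.
move=> M0 det0 v0; apply: contraNT det0; rewrite negb_or !negbK => /andP[/eqP e1 /eqP e2].
pose mon (x : nat) := v 0 ^+ x * v 1 ^+ ((m1 + m2).-1 - x).
apply/det0P; exists (\row_x mon x).
  apply: contraTneq v0 => /rowP mon0; rewrite negb_or !negbK.
  have lt1 : ((m1 + m2).-1 < m1 + m2)%N by rewrite ltn_predL.
  have := mon0 (Ordinal lt1); have := mon0 (Ordinal M0).
  rewrite !mxE /mon /= subnn subn0 !expr0 mul1r mulr1.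
  by move=> /eqP; rewrite expf_eq0 => /andP[_ ->] /eqP; rewrite expf_eq0 => /andP[_ ->].
have shift m m' (c : 'I_m.+1 -> K) (y : 'I_m') : (m + m' = m1 + m2)%N -> form_val c v = 0 ->
    \sum_(x < m1 + m2) mon x * (\sum_l c l * ((x : nat) == (y + l)%N)%:R) = 0.
  move=> mm c0; under eq_bigr do rewrite mulr_sumr.
  have -> : \sum_(x < m1 + m2) \sum_l mon x * (c l * ((x : nat) == (y + l)%N)%:R) =
      v 0 ^+ y * v 1 ^+ (m'.-1 - y) * form_val c v; last by rewrite c0 mulr0.
  rewrite exchange_big mulr_sumr; apply: eq_bigr => l _ /=.
  have lt_yl : (y + l < m1 + m2)%N by have := ltn_ord y; have := ltn_ord l; lia.
  rewrite (bigD1 (Ordinal lt_yl)) //= eqxx mulr1 big1 ?addr0 => [|x xy].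
    rewrite /mon; have -> : ((m1 + m2).-1 - (y + l) = (m'.-1 - y) + (m - l))%N.
      by have := ltn_ord y; have := ltn_ord l; lia.
    by rewrite !exprD; ring.
  case: eqP => [e|_]; last by rewrite !mulr0.
  by case/eqP: xy; apply: val_inj.
apply/rowP => i; rewrite !mxE.
under eq_bigr do rewrite !mxE.
case: (split i) => y; first by apply: shift => //; rewrite addnC.
exact: shift.
Qed.

Lemma sylvester_monomials m1 m2 :
  \det (sylvester (fun l : 'I_m1.+1 => (l == m1 :> nat)%:R)
                  (fun l : 'I_m2.+1 => (l == 0 :> nat)%:R)) = 1.
Proof.
rewrite [X in \det X](_ : _ = 1%:M) ?det1 //; apply/matrixP => x i; rewrite !mxE.
case: (split_ordP i) => y ->.
  rewrite (bigD1 ord0) //= mul1r addn0 big1 ?addr0 // => l l0.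
  by rewrite -[(l : nat) == _]/(l == ord0) (negPf l0) mul0r.
rewrite (bigD1 ord_max) //= eqxx mul1r [(y + m1)%N]addnC big1 ?addr0 // => l l0.
by rewrite -[(l : nat) == _]/(l == ord_max) (negPf l0) mul0r.
Qed.

Lemma polyfun_det_sylvester T m1 m2 (c1 : (T -> K) -> 'I_m1.+1 -> K)
    (c2 : (T -> K) -> 'I_m2.+1 -> K) :
    (forall l, polyfun (c1^~ l)) -> (forall l, polyfun (c2^~ l)) ->
  polyfun (fun z => \det (sylvester (c1 z) (c2 z))).
Proof.
move=> p1 p2; apply: polyfun_det => x i.
by case: (split i) => y; apply: polyfun_sum => l; apply: PolyMul (PolyConst _ _).
Qed.

End Sylvester.

(** * Solvability of the interpolation equations for general data *)

Section GenericSolvability.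
Local Open Scope ring_scope.
Variables (K : closedFieldType) (a s e d k m : nat).
Local Notation n := m.+1.
Local Notation params := (params a s e d k n).
Local Notation targets := (targets a s n).

(** A polynomial condition that excludes base points: the first resultant keeps two of the forms [g]
    from vanishing together, the second does so for [F_0] and [h], hence [(F, h g)] has no common
    zero either. *)
Definition good (x : params -> K) : K :=
  (\prod_i bet x i * \prod_i lam x i) *
  (\det (sylvester (gco x ord0) (gco x ord_max)) * \det (sylvester (fco x ord0) (hco x))).

Lemma good_neq0 x :
  good x != 0 <-> [/\ forall i, bet x i != 0, forall i, lam x i != 0,
    \det (sylvester (gco x ord0) (gco x ord_max)) != 0
    & \det (sylvester (fco x ord0) (hco x)) != 0].
Proof.
rewrite /good !mulf_eq0 !negb_or -!andbA; split.
  by case/and4P => /prodf_neq0 b /prodf_neq0 l d1 d2; split=> // i; [apply: b | apply: l].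
by case=> b l -> ->; rewrite !andbT; apply/andP; split; apply/prodf_neq0.
Qed.

Lemma polyfun_good : polyfun good.
Proof.
have px c : polyfun (fun x : params -> K => x c) by exact: PolyVar.
apply: PolyMul; apply: PolyMul.
- by apply: polyfun_prod => i; apply: px.
- by apply: polyfun_prod => i; apply: px.
- by apply: (polyfun_det_sylvester (c1 := fun x => gco x ord0)) => l; apply: px.
- by apply: (polyfun_det_sylvester (c1 := fun x => fco x ord0) (c2 := @hco _ _ _ _ _ _ _)) => l; apply: px.
Qed.

Lemma good_somewhere : (0 < a)%N -> exists x, good x != 0.
Proof.
move=> a0.
(* In coordinates [v0], [v1], this takes [g_0 = v0^e], the other [g_j = v1^e], [F_j = v0^d] and
   [h = v1^k]. Both Sylvester matrices are then identities. *)
exists (fun c : params => match c with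
  | inl (j, l) => if j == ord0 then (l == e :> nat)%:R else (l == 0 :> nat)%:R
  | inr (inl l) => (l == 0 :> nat)%:R
  | inr (inr (inl (j, l))) => (l == d :> nat)%:R
  | _ => 1
  end).
apply/good_neq0; split=> [i|i||]; rewrite ?oner_eq0 //.
  rewrite [X in \det X](_ : _ = sylvester (fun l : 'I_e.+1 => (l == e :> nat)%:R)
                  (fun l : 'I_e.+1 => (l == 0 :> nat)%:R)).
    by rewrite sylvester_monomials oner_eq0.
  have max0 : (ord_max == ord0 :> 'I_a.+1) = false by rewrite -val_eqE /= gtn_eqF.
  by rewrite /gco eqxx max0.
rewrite [X in \det X](_ : _ = sylvester (fun l : 'I_d.+1 => (l == d :> nat)%:R)
                  (fun l : 'I_k.+1 => (l == 0 :> nat)%:R)) //.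
by rewrite sylvester_monomials oner_eq0.
Qed.

Hypotheses (a0 : (0 < a)%N) (dE : d = (e + k)%N) (hA : (a * m <= a.+1 * e)%N)
  (hB : ((a + s.+1) * m + a * k <= (a + s.+2) * d)%N).

(** The point where the differential is surjective may have base points. It only serves to show that
    [R] composed with the data is not identically 0; irreducibility then provides a point that is
    [good] as well. *)
Lemma interp_data_dominant (P : 'I_n -> K) (R : (targets -> K) -> K) :
    injective P -> polyfun R -> (exists w, R w != 0) ->
  exists x, good x != 0 /\ R (interp_data (affine P) x) != 0.
Proof.
move=> Pinj pR [w Rw].
have pRP : polyfun (fun x : params -> K => R (interp_data (affine P) x)).
  apply: (polyfun_comp (g := fun w x => interp_data (affine P) x w)) pR _ => w'.
  apply: (polyfun_interp_data (p := fun=> affine P) (x := id)) => [i l|c].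
    exact: PolyConst.
  exact: PolyVar.
have [R0|[x Rx]] := polyfun_zero_dec pRP; last first.
  have [x1 gx1] := good_somewhere a0.
  by have [u [u1 u2]] := polyfun_common_nonzero polyfun_good pRP gx1 Rx; exists u.
have [x0 [b1 l1 surj]] := tangent_surjective Pinj dE hA hB.
case/eqP: Rw; apply: dominant_of_surjective_differential (x0) _ _ pR R0 _ => z.
have [x xz] := surj z; have [q hq] := interp_data_expand (affine P) x b1 l1.
by exists x, q => w' c; rewrite hq xz.
Qed.

Definition solvable (v : 'I_n * 'I_2 + targets -> K) : Prop :=
  exists x, (forall w, interp_data (fun i t => v (inl (i, t))) x w = v (inr w)) /\
    good x != 0.

(** Forms of degree [j] scale by [p i 1 ^+ j]. Absorbing the scales for [g] and [h] in [bet] and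
    [lam] also absorbs the one for [F], because [d = e + k]. *)
Lemma solvable_rescale (p : 'I_n -> 'I_2 -> K) (x : params -> K) :
    (forall i, p i 1 != 0) -> good x != 0 ->
  exists x', good x' != 0 /\
    interp_data p x' =1 interp_data (affine (fun i => p i 0 / p i 1)) x.
Proof.
move=> p1 gx.
exists (fun c => match c with
  | inr (inr (inr (inl i))) => p i 1 ^- e * x c
  | inr (inr (inr (inr i))) => p i 1 ^- k * x c
  | _ => x c
  end).
have scale i j (c : 'I_j.+1 -> K) :
    form_val c (p i) = p i 1 ^+ j * form_val c (affine (fun i => p i 0 / p i 1) i).
  rewrite form_val_affine mulr_sumr; apply: eq_bigr => l _.
  rewrite [RHS]mulrCA /= expr_div_n [X in _ = _ * X]mulrCA; congr (_ * (_ * _)).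
  by rewrite -expfB_cond ?(negPf (p1 i)) ?add0n // -ltnS.
have pn0 i j : p i 1 ^+ j != 0 by rewrite expf_neq0.
split.
  case/good_neq0: gx => b l d1 d2; apply/good_neq0; split=> // i.
    by rewrite /bet mulf_neq0 ?invr_eq0 // b.
  by rewrite /lam mulf_neq0 ?invr_eq0 // l.
case=> i [j|[j|[]]]; rewrite /interp_data /= scale /bet /lam.
- by rewrite [LHS]mulrACA mulVf ?mul1r.
- by rewrite [X in X * _]mulrACA [LHS]mulrACA -invfM -exprD -dE mulVf ?mul1r.
- by rewrite [LHS]mulrACA mulVf ?mul1r.
Qed.

(** Otherwise the equations are unsolvable wherever some nonzero [R] does not vanish. Fixing
    distinct points [p] at which [R] is still nonzero in the targets contradicts dominance for that
    [p]. *)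
Lemma generic_solvable : polyfun_generic solvable.
Proof.
pose E (w : targets) (v : ('I_n * 'I_2 + targets) + params -> K) : K :=
  interp_data (fun i t => v (inl (inl (i, t)))) (fun c => v (inr c)) w - v (inl (inr w)).
pose D (v : ('I_n * 'I_2 + targets) + params -> K) : K := good (fun c => v (inr c)).
have pE w : polyfun (E w).
  apply: polyfun_sub; last exact: PolyVar.
  apply: (polyfun_interp_data (p := fun v i t => v (inl (inl (i, t))))
    (x := fun v c => v (inr c))) => *; exact: PolyVar.
have pD : polyfun D.
  apply: (polyfun_comp (g := fun c v => v (inr c)) polyfun_good) => *; exact: PolyVar.
have [|] := solvable_generic_or_not pE pD.
  case=> R [pR nR hR]; exists R; split=> // v /hR [x [h1 h2]]; exists x; split=> // w.
  by apply/eqP; rewrite -subr_eq0; apply/eqP/h1.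
case=> R [pR [v0 Rv0] hR].
(* Nonvanishing on the diagonal keeps [p i] away from infinity; off the diagonal it separates [p i]
   from [p j]. *)
pose F (ij : 'I_n * 'I_n) (v : 'I_n * 'I_2 + targets -> K) : K :=
  if ij.1 == ij.2 then v (inl (ij.1, 1)) else
  v (inl (ij.1, 0)) * v (inl (ij.2, 1)) - v (inl (ij.2, 0)) * v (inl (ij.1, 1)).
have pF ij : polyfun (F ij).
  rewrite /F; case: eqP => _; first exact: PolyVar.
  by apply: polyfun_sub; apply: PolyMul; apply: PolyVar.
have nF ij : exists v, F ij v != 0.
  rewrite /F; case: eqP => [_|/eqP ne]; first by exists (fun=> 1); rewrite oner_eq0.
  exists (fun c => match c with
    | inl (i, t) => ((t : 'I_2) == (if i == ij.1 then 0 else 1))%:R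
    | inr _ => 0
    end).
  by rewrite eqxx [ij.2 == _]eq_sym (negPf ne) !eqxx mulr1 mulr0 subr0 oner_eq0.
have [v1 nv1] := polyfun_prod_nonzero pF nF.
have [v [Rv nv]] := polyfun_common_nonzero pR (polyfun_prod (index_enum _) predT pF) Rv0 nv1.
pose p i t := v (inl (i, t)).
have {}nv ij : F ij v != 0 by move/prodf_neq0: nv; apply.
have p1 i : p i 1 != 0 by have := nv (i, i); rewrite /F eqxx.
pose P i := p i 0 / p i 1.
have Pinj : injective P.
  move=> i j Pij; apply/eqP; apply: contraTT (nv (i, j)) => /negPf ij.
  rewrite /F /= ij negbK subr_eq0 -!/(p _ _).
  by rewrite -[p i 0](divfK (p1 i)) -[p j 0](divfK (p1 j)) -/(P i) -/(P j) Pij mulrAC.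
pose Rp (w : targets -> K) := R (join (fun c => v (inl c)) w).
have pRp : polyfun Rp.
  apply: (polyfun_comp (g := fun c w => join (fun c => v (inl c)) w c) pR) => -[c|c].
    exact: PolyConst.
  exact: PolyVar.
have nRp : exists w, Rp w != 0.
  exists (fun c => v (inr c)); rewrite /Rp (polyfun_eq pR (w := v)) //.
  by case.
have [x [gx Rx]] := interp_data_dominant Pinj pRp nRp.
have [x' [gx' ex']] := solvable_rescale p1 gx.
case: (hR _ Rx); exists x'; split=> //.
by move=> w; rewrite /E /= -[X in _ - X]ex' subrr.
Qed.

End GenericSolvability.

(** * Binary forms and points of the blow-up *)

Section BinaryForms.
Local Open Scope ring_scope.
Variable K : closedFieldType.

Definition mon2 (l j : nat) : 'X_{1..2} := [multinom (if i == 0%R then l else j) | i < 2].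

Definition binary_form m (c : 'I_m.+1 -> K) : {mpoly K[2]} :=
  \sum_(l < m.+1) c l *: 'X_[mon2 l (m - l)].

Lemma mdeg_mon2 l j : mdeg (mon2 l j) = (l + j)%N.
Proof. by rewrite mdegE big_ord_recl big_ord1 !mnmE. Qed.

Lemma binary_form_homog m (c : 'I_m.+1 -> K) : binary_form c \is m.-homog.
Proof.
apply: rpred_sum => l _; apply: rpredZ; rewrite dhomogX /= mdeg_mon2.
by rewrite subnKC // -ltnS.
Qed.

Lemma binary_form_eval m (c : 'I_m.+1 -> K) v : (binary_form c).@[v] = form_val c v.
Proof.
rewrite raddf_sum; apply: eq_bigr => l _; rewrite /= mevalZ mevalX.
rewrite big_ord_recl big_ord1 !mnmE; congr (_ * (_ * v _ ^+ _)).
exact: val_inj.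
Qed.

Lemma homog_form_val m (q : {mpoly K[2]}) : q \is m.-homog ->
  exists c : 'I_m.+1 -> K, forall v, q.@[v] = form_val c v.
Proof.
move=> hq; exists (fun l => q@_(mon2 l (m - l))) => v; rewrite -binary_form_eval.
congr (meval v _); apply/mpolyP => mn; rewrite /binary_form raddf_sum /=.
have [dm|dm] := eqVneq (mdeg mn) m; last first.
  rewrite (dhomog_nemf_coeff hq dm) big1 // => l _; rewrite mcoeffZ mcoeffX.
  case: eqP => [e|]; last by rewrite mulr0.
  by case/eqP: dm; rewrite -e mdeg_mon2 subnKC // -ltnS.
have m2 : mn 0 = (m - mn 1%R)%N /\ mn 1 = (m - mn 0%R)%N.
  have -> : 1 = lift ord0 ord0 :> 'I_2 by apply: val_inj.
  by rewrite -dm mdegE big_ord_recl big_ord1 addKn addnK.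
have lm : (mn 0%R < m.+1)%N by rewrite m2.1 ltnS leq_subr.
have mnE : mn = mon2 (mn 0) (m - mn 0).
  apply/mnmP => i; rewrite mnmE -m2.2; case: eqP => [->//|].
  case: i => [[|[|//]]] hi ne; first by case: ne; apply: val_inj.
  by congr (mn _); apply: val_inj.
rewrite (bigD1 (Ordinal lm)) //= mcoeffZ mcoeffX -mnE eqxx mulr1 big1 ?addr0 // => l ll.
rewrite mcoeffZ mcoeffX; case: eqP => [e|]; last by rewrite mulr0.
by case/eqP: ll; apply: val_inj; rewrite /= -e mnmE.
Qed.

Lemma form_val_scale m (c : 'I_m.+1 -> K) z (v : 'I_2 -> K) :
  form_val c (fun t => z * v t) = z ^+ m * form_val c v.
Proof.
rewrite /form_val mulr_sumr; apply: eq_bigr => l _.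
rewrite !exprMn [RHS]mulrCA; congr (_ * _); rewrite mulrACA -exprD subnKC //.
by rewrite -ltnS.
Qed.

Lemma homog_eval_scale m (q : {mpoly K[2]}) z (v : 'I_2 -> K) : q \is m.-homog ->
  q.@[fun t => z * v t] = z ^+ m * q.@[v].
Proof. by case/homog_form_val => c cE; rewrite !cE form_val_scale. Qed.

Lemma projpt1_neq0 (v : projpt K 1) : (pcoord v 0 0 != 0) || (pcoord v 0 1 != 0).
Proof.
apply: contraNT (pcoord_neq0 v); rewrite negb_or !negbK => /andP[/eqP v0 /eqP v1].
apply/eqP/rowP => -[[|[|//]] hi]; rewrite mxE.
  by rewrite -[RHS]v0; congr (pcoord v 0 _); apply: val_inj.
by rewrite -[RHS]v1; congr (pcoord v 0 _); apply: val_inj.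
Qed.

End BinaryForms.

(** * Splitting the coordinates of the ambient space along the blown-up subspace *)

Section Coordinates.
Variables (r s : nat) (hs : s.+2 <= r).

Definition head_index (j : 'I_s.+1) : 'I_r.+1 := inord j.

Definition glue T (u : 'I_s.+1 -> T) (z : 'I_(r - s - 1).+1 -> T) (l : 'I_r.+1) : T :=
  if l <= s then u (inord l) else z (inord (l - s.+1)).

Lemma val_head j : head_index j = j :> nat.
Proof. by rewrite inordK //; have := ltn_ord j; lia. Qed.

Lemma val_tail i : @tail r s i = (s.+1 + i) :> nat.
Proof. by rewrite inordK //; have := ltn_ord i; lia. Qed.

Lemma glue_head T (u : 'I_s.+1 -> T) z j : glue u z (head_index j) = u j.
Proof. by rewrite /glue val_head -ltnS ltn_ord inord_val. Qed.

Lemma glue_tail T (u : 'I_s.+1 -> T) z i : glue u z (@tail r s i) = z i.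
Proof. by rewrite /glue val_tail ltnNge leq_addr addKn inord_val. Qed.

Lemma head_tail_ind (P : 'I_r.+1 -> Prop) :
  (forall j, P (head_index j)) -> (forall i, P (@tail r s i)) -> forall l, P l.
Proof.
move=> Ph Pt l; have [ls|sl] := leqP l s.
  have -> : l = head_index (inord l) by apply: ord_inj; rewrite val_head inordK.
  exact: Ph.
have -> : l = @tail r s (inord (l - s.+1)); last exact: Pt.
by apply: ord_inj; rewrite val_tail inordK; have := ltn_ord l; lia.
Qed.

End Coordinates.

(** * From interpolation data to maps and back *)

Section Interpolation.
Local Open Scope ring_scope.
Variables (K : closedFieldType) (r s d k : nat).
Hypotheses (hs : (s.+2 <= r)%N) (hk : (k < d)%N).
Local Notation a := (r - s - 1)%N.
Local Notation e := (d - k)%N.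
Local Notation tl := (@tail r s).
Local Notation hd := (@head_index r s).

(** The map is [((F, h g), g)]. Incidence holds because the tail coordinates are multiples of [g] by
    [h]; the two resultants exclude base points. *)
Lemma blowup_map_of_forms (gc : 'I_a.+1 -> 'I_e.+1 -> K) (hc : 'I_k.+1 -> K)
    (fc : 'I_s.+1 -> 'I_d.+1 -> K) :
    \det (sylvester (gc ord0) (gc ord_max)) != 0 ->
    \det (sylvester (fc ord0) hc) != 0 ->
  exists f : blowup_map K r s, [/\ has_degree f d k,
    forall v l, pcoord (blowdown (blowup_eval f v)) 0 l =
      glue (fun j => form_val (fc j) (pcoord v 0))
           (fun j => form_val hc (pcoord v 0) * form_val (gc j) (pcoord v 0)) l
    & forall v j, pcoord (proj (blowup_eval f v)) 0 j = form_val (gc j) (pcoord v 0)].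
Proof.
move=> det1 det2.
pose F := glue (fun j => binary_form (fc j)) (fun j => binary_form hc * binary_form (gc j)).
have Feval l v : (F l).@[v] =
    glue (fun j => form_val (fc j) v) (fun j => form_val hc v * form_val (gc j) v) l.
  by rewrite /F /glue; case: ifP => _; rewrite ?mevalM !binary_form_eval.
have Fhom l : F l \is d.-homog.
  rewrite /F; elim/(head_tail_ind hs): l => i.
    by rewrite glue_head //; apply: binary_form_homog.
  rewrite glue_tail // -[X in X.-homog](subnKC (ltnW hk)).
  by apply: dhomogM; apply: binary_form_homog.
have gbpf (v : projpt K 1) : exists j, form_val (gc j) (pcoord v 0) != 0.
  have e0 : (0 < e + e)%N by rewrite addn_gt0 subn_gt0 hk.
  by have /orP[] := sylvester_no_common_zero e0 det1 (projpt1_neq0 v); [exists ord0 | exists ord_max].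
have Gbpf (v : projpt K 1) : exists j, (binary_form (gc j)).@[pcoord v 0] != 0.
  by have [j gj] := gbpf v; exists j; rewrite binary_form_eval.
have Fbpf (v : projpt K 1) : exists l, (F l).@[pcoord v 0] != 0.
  have d0 : (0 < d + k)%N by rewrite addn_gt0 (leq_trans _ hk).
  have /orP[f0|h0] := sylvester_no_common_zero d0 det2 (projpt1_neq0 v).
    by exists (hd ord0); rewrite Feval glue_head.
  have [j gj] := gbpf v; exists (tl j).
  by rewrite Feval glue_tail // mulf_neq0.
pose FF := P1Map Fhom Fbpf.
pose GG := P1Map (fun j => binary_form_homog (gc j)) Gbpf.
have inc (v : projpt K 1) : incident (p1eval FF v) (p1eval GG v).
  move=> i j; rewrite /= !mxE /= !Feval !glue_tail // !binary_form_eval; ring.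
exists (BlowupMap inc); split=> [|v l|v j].
- by split=> //=; rewrite /exceptional_degree /= subzn ?leq_subr // subKn // ltnW.
- by rewrite /= mxE /= Feval.
- by rewrite /= mxE /= binary_form_eval.
Qed.

(** Multiplying the coordinates of the blowdown by [y_0] turns them into [(y_0 u, x_tail0 y)]. This
    brings the point to the normal form of [interp_data] without division, so the data stay
    polynomial in the coordinates. *)
Lemma interpolating_map n (p : 'I_n.+1 -> projpt K 1) (x : 'I_n.+1 -> blowup K r s)
    (c : params a s e d k n.+1 -> K) :
    good c != 0 -> (forall i, pcoord (proj (x i)) 0 0 != 0) ->
    (forall i j, interp_data (fun i => pcoord (p i) 0) c (i, inl j) =
       pcoord (proj (x i)) 0 j) ->
    (forall i j, interp_data (fun i => pcoord (p i) 0) c (i, inr (inl j)) =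
       pcoord (proj (x i)) 0 0 * pcoord (blowdown (x i)) 0 (hd j)) ->
    (forall i, interp_data (fun i => pcoord (p i) 0) c (i, inr (inr tt)) =
       pcoord (blowdown (x i)) 0 (tl 0)) ->
  exists f : blowup_map K r s, has_degree f d k /\
    forall i, same_blowup_point (blowup_eval f (p i)) (x i).
Proof.
move=> /good_neq0 [b0 l0 det1 det2] y0 ey eu et.
have [f [fd fx fy]] := blowup_map_of_forms det1 det2; exists f; split=> // i.
split.
  exists ((bet c i * lam c i)^-1 * pcoord (proj (x i)) 0 0).
    by rewrite mulf_neq0 ?invr_eq0 ?mulf_neq0.
  apply/rowP => l; rewrite [LHS]fx [RHS]mxE -mulrA.
  apply: (canRL (mulKf _)); first by rewrite mulf_neq0.
  elim/(head_tail_ind hs): l => j; rewrite ?glue_head ?glue_tail //.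
    by rewrite -eu.
  have := blowup_incident (x i) 0 j; rewrite mulrC -ey -et -ey /interp_data /=.
  rewrite [X in _ = X]mulrC => <-; ring.
exists (bet c i)^-1; first by rewrite invr_eq0.
by apply/rowP => j; rewrite fy [RHS]mxE -ey /interp_data /= mulKf.
Qed.

Lemma same_point_trans m (u v w : projpt K m) :
  same_point u v -> same_point v w -> same_point u w.
Proof.
case=> c c0 uv [c' c'0 vw]; exists (c * c'); first by rewrite mulf_neq0.
by rewrite uv vw scalerA.
Qed.

Lemma same_point_sym m (u v : projpt K m) : same_point u v -> same_point v u.
Proof.
case=> c c0 uv; exists c^-1; first by rewrite invr_eq0.
by rewrite uv scalerA mulVf // scale1r.
Qed.

Lemma same_blowup_point_trans (x y z : blowup K r s) :
  same_blowup_point x y -> same_blowup_point y z -> same_blowup_point x z.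
Proof. by case=> h1 h2 [h3 h4]; split; [apply: same_point_trans h3 | apply: same_point_trans h4]. Qed.

Lemma same_blowup_point_sym (x y : blowup K r s) :
  same_blowup_point x y -> same_blowup_point y x.
Proof. by case=> h1 h2; split; apply: same_point_sym. Qed.

Lemma p1eval_same m j (f : p1map K m j) (v w : projpt K 1) :
  same_point v w -> same_point (p1eval f v) (p1eval f w).
Proof.
case=> c c0 vw; exists (c ^+ j); first by rewrite expf_neq0.
apply/rowP => l; rewrite /= !mxE -homog_eval_scale ?form_homog //.
by apply: meval_eq => t; rewrite vw mxE.
Qed.

Lemma blowup_eval_same (f : blowup_map K r s) (v w : projpt K 1) :
  same_point v w -> same_blowup_point (blowup_eval f v) (blowup_eval f w).
Proof. by move=> vw; split; apply: p1eval_same. Qed.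

Lemma interp_data_of_map n (p : 'I_n.+1 -> projpt K 1) (x : 'I_n.+1 -> blowup K r s)
    (w : targets a s n.+1 -> K) (f : blowup_map K r s) :
    (forall i j, pcoord (proj (x i)) 0 j = w (i, inl j)) ->
    (forall i j, pcoord (blowdown (x i)) 0 (hd j) = w (i, inr (inl j))) ->
    (forall i j, pcoord (blowdown (x i)) 0 (tl j) = w (i, inr (inr tt)) * w (i, inl j)) ->
    (forall i, w (i, inl 0) != 0) -> (forall i, w (i, inr (inr tt)) != 0) ->
    has_degree f d k -> (forall i, same_blowup_point (blowup_eval f (p i)) (x i)) ->
  exists c : params a s e d k n.+1 -> K,
    [/\ forall i, bet c i != 0, forall i, lam c i != 0
      & interp_data (fun i => pcoord (p i) 0) c =1 w].
Proof.
move=> xy xu xt y0 t0 fd fpx.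
have [|k' [h [fk' h0 hk' fh]]] := @exceptional_degreeP K r s f.
  (* The first interpolated point has [t] and [y_0] nonzero, so the curve is not contained in the
     exceptional divisor and the form [h] exists. *)
  exists (p 0) => exc; have [[c c0 e0] _] := fpx 0.
  have := exc 0; rewrite e0 mxE xt => /eqP.
  by rewrite !mulf_eq0 (negPf c0) (negPf (t0 _)) (negPf (y0 _)).
case: fd => fd fk; move: fk'; rewrite fk => -[kk']; subst k'.
case: f fd fk fh fpx => d' e' F G inc /= dd'; subst d'.
rewrite /exceptional_degree /= => ek fh fpx.
have ee : e' = e by lia.
subst e'.
have [gc gcE] := fin_all_exists (fun j => homog_form_val (form_homog G j)).
have [fc fcE] := fin_all_exists (fun j => homog_form_val (form_homog F (hd j))).
have [hc hcE] := homog_form_val hk'.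
have [A A0 AE] := fin_all_exists2 (fun i => (fpx i).1).
have [B B0 BE] := fin_all_exists2 (fun i => (fpx i).2).
(* With [g (p i) = B i * y] and [F (p i) = A i * u], the scalars must satisfy [bet = 1 / B] and
   [bet * lam = 1 / A]. *)
exists (fun c => match c with
  | inl (j, l) => gc j l
  | inr (inl l) => hc l
  | inr (inr (inl (j, l))) => fc j l
  | inr (inr (inr (inl i))) => (B i)^-1
  | inr (inr (inr (inr i))) => B i / A i
  end).
have yE i j : form_val (gc j) (pcoord (p i) 0) = B i * w (i, inl j).
  by rewrite -gcE -xy; have /rowP /(_ j) := BE i; rewrite !mxE.
have FE i l : (Defs.form F l).@[pcoord (p i) 0] = A i * pcoord (blowdown (x i)) 0 l.
  by have /rowP /(_ l) := AE i; rewrite !mxE.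
have uE i j : form_val (fc j) (pcoord (p i) 0) = A i * w (i, inr (inl j)).
  by rewrite -fcE FE xu.
have tE i : form_val hc (pcoord (p i) 0) * B i = A i * w (i, inr (inr tt)).
  have := FE i (tl 0); rewrite fh mevalM hcE gcE yE xt !mulrA; exact: mulIf.
split=> [i|i|]; rewrite /bet /lam ?mulf_neq0 ?invr_eq0 //.
case=> i [j|[j|[]]]; rewrite /interp_data /bet /lam /gco /fco /hco /=.
- by rewrite yE mulKf.
- by rewrite uE !mulKf.
- by rewrite mulrAC [B i * _]mulrC tE mulrC mulKf.
Qed.

End Interpolation.

(** * General points and multihomogeneous polynomials *)

Section GeneralPoints.
Local Open Scope ring_scope.
Variables (K : closedFieldType) (r s n : nat).
Local Notation coord := (Defs.coord r s n).

Definition weight (m : 'X_{1..#|coord|}) (b : 'I_n * 'I_3) : nat :=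
  (\sum_(c : coord | factor c == b) m (enum_rank c))%N.

(* Q.@[z . v] is a polynomial in the scalars z b, whose coefficients are the
   values at v of the multihomogeneous components of Q. *)
Lemma multihomogeneous_component (Q : {mpoly K[#|coord|]}) (v : coord -> K) :
    Q.@[fun j => v (enum_val j)] != 0 ->
  exists Qe : {mpoly K[#|coord|]}, [/\ multihomogeneous Qe,
    Qe.@[fun j => v (enum_val j)] != 0
    & forall u, Qe.@[fun j => u (enum_val j)] != 0 ->
      exists2 z : 'I_n * 'I_3 -> K, forall b, z b != 0
        & Q.@[fun j => z (factor (enum_val j)) * u (enum_val j)] != 0].
Proof.
pose wt m : 'X_{1..#|{: 'I_n * 'I_3}|} := [multinom weight m (enum_val b) | b < _].
pose comp w := \sum_(m <- msupp Q | wt m == w) Q@_m *: 'X_[m].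
pose Z (u : coord -> K) : {mpoly K[#|{: 'I_n * 'I_3}|]} :=
  \sum_(m <- msupp Q) (Q@_m * \prod_j u (enum_val j) ^+ m j) *: 'X_[wt m].
have Zcoef u w : (Z u)@_w = (comp w).@[fun j => u (enum_val j)].
  rewrite /comp /Z !raddf_sum [RHS]big_mkcond /=; apply: eq_bigr => m _.
  rewrite mcoeffZ mcoeffX.
  by case: eqP => _; rewrite ?mulr1 ?mulr0 // mevalZ mevalX.
have Zeval u z : (Z u).@[z] =
    Q.@[fun j => z (enum_rank (factor (enum_val j))) * u (enum_val j)].
  rewrite [RHS]mevalE /Z raddf_sum; apply: eq_bigr => m _.
  rewrite /= mevalZ mevalX -mulrA; congr (_ * _).
  under [RHS]eq_bigr do rewrite exprMn.
  rewrite big_split /= mulrC; congr (_ * _).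
  rewrite [RHS](reindex _ (onW_bij _ (enum_rank_bij coord))) /=.
  rewrite [RHS](partition_big (@factor r s n) predT) //=.
  rewrite [LHS](reindex _ (onW_bij _ (enum_rank_bij _))) /=.
  apply: eq_bigr => b _; rewrite mnmE enum_rankK /weight -prodrXr.
  by apply: eq_bigr => c /eqP <-; rewrite enum_rankK.
move=> Qv.
have Zv0 : Z v != 0.
  apply: contraNneq Qv => Z0; have := Zeval v (fun=> 1); rewrite Z0 meval0 => ->.
  by apply/eqP/meval_eq => j; rewrite mul1r.
exists (comp (mlead (Z v))); split; last 1 first.
- move=> u nu.
  have Z0 : Z u != 0 by apply: contraNneq nu => Z0; rewrite -Zcoef Z0 mcoeff0.
  (* The product of all variables forces every scalar to be nonzero. *)
  have [z] : exists z, (Z u * \prod_b 'X_b).@[z] != 0.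
    apply: mpoly_nonroot; rewrite mulf_neq0 //; apply/prodf_neq0 => b _.
    by rewrite -mleadc_eq0 mleadXm mcoeffX eqxx oner_eq0.
  rewrite mevalM mulf_eq0 negb_or => /andP[Zz]; rewrite rmorph_prod => /prodf_neq0 z0.
  exists (fun b => z (enum_rank b)) => [b|]; last by rewrite -Zeval.
  by have := z0 (enum_rank b) isT; rewrite /= mevalXU.
- exists (fun b => mlead (Z v) (enum_rank b)) => m sm b.
  have /eqP <- : wt m == mlead (Z v).
    apply: contraLR sm => nm; rewrite mcoeff_msupp negbK /comp raddf_sum big1 //= => m' /eqP mw.
    rewrite mcoeffZ mcoeffX; case: eqP => [e|]; last by rewrite mulr0.
    by rewrite -e mw eqxx in nm.
  by rewrite mnmE enum_rankK.
- by rewrite -Zcoef mleadc_eq0.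
Qed.

(** [R] need not be multihomogeneous: where a suitable component of it is nonzero, [R] is nonzero at
    rescaled coordinates of the same points, and [P] does not depend on the choice of
    coordinates. *)
Lemma for_general_points_of_polyfun
    (P : ('I_n -> projpt K 1) -> ('I_n -> blowup K r s) -> Prop) (R : (coord -> K) -> K) :
    polyfun R -> (exists p x, R (coord_val p x) != 0) ->
    (forall p x, R (coord_val p x) != 0 -> P p x) ->
    (forall p p' x x', (forall i, same_point (p i) (p' i)) ->
       (forall i, same_blowup_point (x i) (x' i)) -> P p' x' -> P p x) ->
  for_general_points P.
Proof.
move=> pR [p [x Rpx]] RP Pinv; have [Q QE] := polyfun_mpoly pR.
have := Rpx; rewrite QE => /multihomogeneous_component [Qe [hQe nQe hz]].
exists Qe; split=> //; first by exists p, x.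
move=> {nQe Rpx} {}p {}x /hz [z z0 nQ].
have sc_neq0 m c (v : projpt K m) : c != 0 -> c *: pcoord v != 0.
  by move=> c0; rewrite scaler_eq0 negb_or c0 pcoord_neq0.
pose sc m c (c0 : c != 0) (v : projpt K m) := ProjPt (sc_neq0 m c v c0).
have inc i : incident (sc _ _ (z0 (i, inord 1)) (blowdown (x i)))
                      (sc _ _ (z0 (i, inord 2)) (proj (x i))).
  move=> j l; rewrite /= !mxE mulrACA blowup_incident; ring.
pose p' i := sc _ _ (z0 (i, inord 0)) (p i).
pose x' i := BlowupPt (inc i).
apply: (Pinv p p' x x').
- move=> i; apply: same_point_sym.
  by exists (z (i, inord 0)).
- move=> i; apply: same_blowup_point_sym.
  by split; [exists (z (i, inord 1)) | exists (z (i, inord 2))].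
apply: RP; rewrite QE; apply: contraNneq nQ => <-; apply/eqP/meval_eq => j.
by case: (enum_val j) => i [t|[l|l]]; rewrite /coord_val /factor /= mxE.
Qed.

End GeneralPoints.

(** * Existence of interpolating maps and bounds on the number of points *)

Section Bounds.
Local Open Scope ring_scope.
Variables (K : closedFieldType) (r s d k : nat).
Hypotheses (hs : (s.+2 <= r)%N) (hk : (k < d)%N).
Local Notation a := (r - s - 1)%N.
Local Notation e := (d - k)%N.
Local Notation tl := (@tail r s).
Local Notation hd := (@head_index r s).

Lemma blowup_point_exists (y : 'I_a.+1 -> K) (u : 'I_s.+1 -> K) (t : K) : y 0 != 0 -> t != 0 ->
  exists x : blowup K r s, [/\ forall j, pcoord (proj x) 0 j = y j,
    forall j, pcoord (blowdown x) 0 (hd j) = u j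
    & forall j, pcoord (blowdown x) 0 (tl j) = t * y j].
Proof.
move=> y0 t0.
have yn0 : \row_j y j != 0 by apply: contraNneq y0 => /rowP /(_ 0); rewrite !mxE => ->.
pose z := glue u (fun j => t * y j).
have zn0 : \row_l z l != 0.
  have : t * y 0 != 0 by rewrite mulf_neq0.
  by apply: contraNneq => /rowP /(_ (tl 0)); rewrite !mxE /z glue_tail // => ->.
have inc : incident (ProjPt zn0) (ProjPt yn0).
  by move=> i j; rewrite /= !mxE /z !glue_tail //; ring.
exists (BlowupPt inc); split=> j; rewrite /= mxE // /z ?glue_head ?glue_tail //.
Qed.

Lemma blowup_points_exist n (w : targets a s n -> K) :
    (forall i, w (i, inl 0) != 0) -> (forall i, w (i, inr (inr tt)) != 0) ->
  exists x : 'I_n -> blowup K r s, [/\ forall i j, pcoord (proj (x i)) 0 j = w (i, inl j),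
    forall i j, pcoord (blowdown (x i)) 0 (hd j) = w (i, inr (inl j))
    & forall i j, pcoord (blowdown (x i)) 0 (tl j) = w (i, inr (inr tt)) * w (i, inl j)].
Proof.
move=> y0 t0.
have [x hx] := fin_all_exists (fun i =>
  @blowup_point_exists (fun j => w (i, inl j)) (fun j => w (i, inr (inl j))) _ (y0 i) (t0 i)).
by exists x; split=> i; case: (hx i).
Qed.

Lemma interpolation_same_points n (p p' : 'I_n -> projpt K 1) (x x' : 'I_n -> blowup K r s) :
    (forall i, same_point (p i) (p' i)) -> (forall i, same_blowup_point (x i) (x' i)) ->
    (exists f : blowup_map K r s, has_degree f d k /\
      forall i, same_blowup_point (blowup_eval f (p' i)) (x' i)) ->
  exists f : blowup_map K r s, has_degree f d k /\
    forall i, same_blowup_point (blowup_eval f (p i)) (x i).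
Proof.
move=> pp xx [f [fd fp]]; exists f; split=> // i.
apply: same_blowup_point_trans (blowup_eval_same f (pp i)) _.
exact: same_blowup_point_trans (fp i) (same_blowup_point_sym (xx i)).
Qed.

Lemma interpolation_exists m :
    (a * m <= a.+1 * e)%N -> ((a + s.+1) * m + a * k <= (a + s.+2) * d)%N ->
  interpolation K r s d k m.+1.
Proof.
move=> hA hB.
have a0 : (0 < a)%N by lia.
have dE : d = (e + k)%N by lia.
have [R [pR [v0 nv0] hR]] := generic_solvable K a0 dE hA hB.
(* These are the data [(y, y_0 u, x_tail0)] required by [interpolating_map]. *)
pose sub (V : Defs.coord r s m.+1 -> K) (c : 'I_m.+1 * 'I_2 + targets a s m.+1) : K :=
  match c with
  | inl (i, t) => V (i, inl t)
  | inr (i, inl j) => V (i, inr (inr j))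
  | inr (i, inr (inl j)) => V (i, inr (inr 0)) * V (i, inr (inl (hd j)))
  | inr (i, inr (inr _)) => V (i, inr (inl (tl 0)))
  end.
have psub c : polyfun (sub^~ c).
  by case: c => [[i t]|[i [j|[j|[]]]]]; [| |apply: PolyMul|]; apply: PolyVar.
pose R' V := R (sub V) * \prod_i V (i, inr (inr 0)).
apply: (for_general_points_of_polyfun (R := R')).
- apply: PolyMul; first exact: polyfun_comp pR psub.
  by apply: polyfun_prod => i; apply: PolyVar.
- pose g (v : 'I_m.+1 * 'I_2 + targets a s m.+1 -> K) :=
    \prod_i (v (inl (i, 0)) * v (inr (i, inl 0)) * v (inr (i, inr (inr tt)))).
  have pg : polyfun g.
    by apply: polyfun_prod => i; apply: PolyMul; [apply: PolyMul|]; apply: PolyVar.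
  have ng : g (fun=> 1) != 0.
    by apply/prodf_neq0 => i _; rewrite !mulr1 oner_eq0.
  have [v [Rv /prodf_neq0 nv]] := polyfun_common_nonzero pR pg nv0 ng.
  have {}nv i : [/\ v (inl (i, 0)) != 0, v (inr (i, inl 0)) != 0 & v (inr (i, inr (inr tt))) != 0].
    by have := nv i isT; rewrite !mulf_eq0 !negb_or => /andP[/andP[]].
  have pn0 i : \row_t v (inl (i, t)) != 0.
    by case: (nv i) => p0 _ _; apply: contraNneq p0 => /rowP /(_ 0); rewrite !mxE => ->.
  (* Dividing [u] and [t] by [y_0] inverts [sub], so that [R] is nonzero at an actual
     configuration. *)
  pose w (c : targets a s m.+1) := match c.2 with
    | inl j => v (inr c)
    | inr _ => v (inr c) / v (inr (c.1, inl 0))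
    end.
  have [||x [xy xu xt]] := @blowup_points_exist _ w.
  + by move=> i; case: (nv i).
  + by move=> i; case: (nv i) => *; rewrite /w /= mulf_neq0 ?invr_eq0.
  exists (fun i => ProjPt (pn0 i)), x.
  rewrite /R' mulf_neq0 //; last first.
    by apply/prodf_neq0 => i _; rewrite /coord_val /= xy; case: (nv i).
  rewrite (polyfun_eq pR (w := v)) // => -[[i t]|[i [j|[j|[]]]]]; rewrite /sub /coord_val /=.
  + by rewrite mxE.
  + by rewrite xy.
  + by rewrite xy xu /w /= mulrC divfK //; case: (nv i).
  + by rewrite xt /w /= divfK //; case: (nv i).
- move=> p x; rewrite mulf_eq0 negb_or => /andP[/hR [c [ec gc]] /prodf_neq0 y0].
  apply: (interpolating_map hs hk gc) => [i|i j|i j|i]; first exact: y0.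
  + exact: (ec (i, inl j)).
  + exact: (ec (i, inr (inl j))).
  + exact: (ec (i, inr (inr tt))).
- exact: interpolation_same_points.
Qed.

(** Once [p] is fixed, [Q] is a nonzero polynomial in the targets. Some target avoids the zeros of
    [Q], of [R] and of all [y_0] and [t]; the map through it supplies the parameters. *)
Lemma interpolation_dominant m : interpolation K r s d k m.+1 ->
  exists p : 'I_m.+1 -> projpt K 1, forall R : (targets a s m.+1 -> K) -> K,
    polyfun R -> (exists w, R w != 0) ->
  exists c : params a s e d k m.+1 -> K, [/\ forall i, bet c i != 0,
    forall i, lam c i != 0 & R (interp_data (fun i => pcoord (p i) 0) c) != 0].
Proof.
case=> Q [_ [p [x Qpx]] hQ]; exists p => R pR [w1 Rw1].
pose V (w : targets a s m.+1 -> K) (c : Defs.coord r s m.+1) : K := match c.2 with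
  | inl t => pcoord (p c.1) 0 t
  | inr (inl l) => glue (fun j => w (c.1, inr (inl j)))
                     (fun j => w (c.1, inr (inr tt)) * w (c.1, inl j)) l
  | inr (inr j) => w (c.1, inl j)
  end.
have pV c : polyfun (V^~ c).
  case: c => i [t|[l|j]]; rewrite /V /=; [exact: PolyConst | | exact: PolyVar].
  by rewrite /glue; case: (l <= s)%N; [|apply: PolyMul]; apply: PolyVar.
pose f w := Q.@[fun j => V w (enum_val j)].
have pf : polyfun f.
  exact: (polyfun_comp (g := fun j w => V w (enum_val j)) (mpoly_polyfun Q)).
have [w0 fw0] : exists w, f w != 0.
  have /fin_all_exists [j jn0] i : exists j, pcoord (proj (x i)) 0 j != 0.
    by apply/rV0Pn; apply: pcoord_neq0.
  (* The target of the given configuration, with [t] computed from an index where [y] is nonzero;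
     incidence yields the other tail coordinates. *)
  exists (fun c => match c.2 with
    | inl j => pcoord (proj (x c.1)) 0 j
    | inr (inl l) => pcoord (blowdown (x c.1)) 0 (hd l)
    | inr (inr _) => pcoord (blowdown (x c.1)) 0 (tl (j c.1)) / pcoord (proj (x c.1)) 0 (j c.1)
    end).
  apply: contraNneq Qpx => <-; apply/eqP/meval_eq => c; rewrite /V /coord_val.
  case: (enum_val c) => i [t|[l|l]] //=.
  elim/(head_tail_ind hs): l => l; rewrite ?glue_head ?glue_tail //.
  by rewrite mulrAC -blowup_incident mulfK.
pose g (w : targets a s m.+1 -> K) := \prod_i (w (i, inl 0) * w (i, inr (inr tt))).
have pg : polyfun g.
  by apply: polyfun_prod => i; apply: PolyMul; apply: PolyVar.
have ng : g (fun=> 1) != 0.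
  by apply/prodf_neq0 => i _; rewrite mulr1 oner_eq0.
have [w2 [Rw2 gw2]] := polyfun_common_nonzero pR pg Rw1 ng.
have nRg : R w2 * g w2 != 0 by rewrite mulf_neq0.
have [w [fw]] := polyfun_common_nonzero pf (PolyMul pR pg) fw0 nRg.
rewrite mulf_eq0 negb_or => /andP[Rw /prodf_neq0 nw].
have y0 i : w (i, inl 0) != 0 by have := nw i isT; rewrite mulf_eq0 negb_or => /andP[].
have t0 i : w (i, inr (inr tt)) != 0.
  by have := nw i isT; rewrite mulf_eq0 negb_or => /andP[].
have [x' [xy xu xt]] := blowup_points_exist y0 t0.
have [f' [fd fp]] : exists f : blowup_map K r s, has_degree f d k /\
    forall i, same_blowup_point (blowup_eval f (p i)) (x' i).
  apply: hQ; apply: contraNneq fw => <-; apply/eqP/meval_eq => c; rewrite /V /coord_val.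
  case: (enum_val c) => i [t|[l|l]] //=.
  by elim/(head_tail_ind hs): l => l; rewrite ?glue_head ?glue_tail.
have [c [b0 l0 ec]] := interp_data_of_map hs hk xy xu xt y0 t0 fd fp.
by exists c; split=> //; rewrite (polyfun_eq pR ec).
Qed.

(** Fixes both scalars at the first point to be 1, which removes the two parameters due to rescaling
    [g] and [h]. *)
Definition normalized m (x : params a s e d k m -> K) (c : params a s e d k m.+1) : K :=
  match c with
  | inl jl => x (inl jl)
  | inr (inl l) => x (inr (inl l))
  | inr (inr (inl jl)) => x (inr (inr (inl jl)))
  | inr (inr (inr (inl i))) =>
      if unlift ord0 i is Some j then x (inr (inr (inr (inl j)))) else 1
  | inr (inr (inr (inr i))) =>
      if unlift ord0 i is Some j then x (inr (inr (inr (inr j)))) else 1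
  end.

(** The scalars of the first point move into the forms: [g], [h] and [F] are multiplied by [beta],
    [lambda] and [beta * lambda]. *)
Lemma interp_data_normalize m p (c : params a s e d k m.+1 -> K) :
    bet c ord0 != 0 -> lam c ord0 != 0 ->
  exists x, interp_data p (normalized x) =1 interp_data p c.
Proof.
move=> b0 l0.
pose x (z : params a s e d k m) : K := match z with
  | inl (j, l) => bet c ord0 * gco c j l
  | inr (inl l) => lam c ord0 * hco c l
  | inr (inr (inl (j, l))) => bet c ord0 * lam c ord0 * fco c j l
  | inr (inr (inr (inl i))) => bet c (lift ord0 i) / bet c ord0
  | inr (inr (inr (inr i))) => lam c (lift ord0 i) / lam c ord0
  end.
exists x.
have sc q z (c1 : 'I_q.+1 -> K) v : form_val (fun l => z * c1 l) v = z * form_val c1 v.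
  by rewrite /form_val mulr_sumr; apply: eq_bigr => l _; rewrite [RHS]mulrA.
have bE i : bet (normalized x) i = bet c i / bet c ord0.
  by rewrite {1}/bet /=; case: unliftP => [j|] ->; rewrite ?divff.
have lE i : lam (normalized x) i = lam c i / lam c ord0.
  by rewrite {1}/lam /=; case: unliftP => [j|] ->; rewrite ?divff.
case=> i [j|[j|[]]]; rewrite /interp_data /= ?bE ?lE.
- by rewrite (sc _ _ (gco c j)) mulrA divfK.
- by rewrite (sc _ _ (fco c j)) [X in X * _]mulrACA -invfM mulrA divfK // mulf_neq0.
- by rewrite (sc _ _ (hco c)) mulrA divfK.
Qed.

Lemma polyfun_normalized m c : polyfun (fun x : params a s e d k m -> K => normalized x c).
Proof.
case: c => [jl|[l|[jl|[i|i]]]]; try exact: PolyVar.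
  by rewrite /normalized; case: unliftP => [j _|_]; [apply: PolyVar | apply: PolyConst].
by rewrite /normalized; case: unliftP => [j _|_]; [apply: PolyVar | apply: PolyConst].
Qed.

(** If the inequality failed, the normalized parameters would be fewer than the targets, and a
    polynomial relation between the targets would contradict dominance. *)
Lemma interpolation_bound_total m : interpolation K r s d k m.+1 ->
  ((a + s.+1) * m + a * k <= (a + s.+2) * d)%N.
Proof.
move=> /interpolation_dominant [p hp]; rewrite leqNgt; apply/negP => big.
pose Phi (w : targets a s m.+1) (x : params a s e d k m -> K) :=
  interp_data (fun i => pcoord (p i) 0) (normalized x) w.
have pPhi w : polyfun (Phi w).
  apply: (polyfun_interp_data (p := fun _ i t => pcoord (p i) 0 t)).
    by move=> *; apply: PolyConst.
  exact: polyfun_normalized.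
have small : (#|{: params a s e d k m}| < #|{: targets a s m.+1}|)%N.
  rewrite !card_prod !card_sum !card_prod card_unit !card_ord.
  have dE : d = (e + k)%N by lia.
  by move: big dE; move: (a) (e) => x y big dE; rewrite dE in big *; lia.
have [R [pR nR R0]] := algebraic_dependence small pPhi.
have [c [b0 l0]] := hp R pR nR.
have [x ex] := interp_data_normalize (fun i => pcoord (p i) 0) (b0 ord0) (l0 ord0).
by rewrite -(polyfun_eq pR ex) R0 eqxx.
Qed.

(** The same count for the projection to the base: the coordinates [y] involve only [g] and [beta],
    that is [a.+1 * e.+1 + m] normalized parameters for [m.+1 * a.+1] coordinates. *)
Lemma interpolation_bound_base m : interpolation K r s d k m.+1 -> (a * m <= a.+1 * e)%N.
Proof.
move=> /interpolation_dominant [p hp]; rewrite leqNgt; apply/negP => big.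
pose fill (z : 'I_a.+1 * 'I_e.+1 + 'I_m -> K) (c : params a s e d k m) : K := match c with
  | inl jl => z (inl jl)
  | inr (inr (inr (inl i))) => z (inr i)
  | _ => 0
  end.
pose Phi (w : 'I_m.+1 * 'I_a.+1) z :=
  interp_data (fun i => pcoord (p i) 0) (normalized (fill z)) (w.1, inl w.2).
have pPhi w : polyfun (Phi w).
  apply: (polyfun_interp_data (p := fun _ i t => pcoord (p i) 0 t)).
    by move=> *; apply: PolyConst.
  move=> c; apply: (polyfun_comp (polyfun_normalized c)).
  by case=> [jl|[l|[jl|[i|i]]]]; try exact: PolyConst; exact: PolyVar.
have small : (#|{: 'I_a.+1 * 'I_e.+1 + 'I_m}| < #|{: 'I_m.+1 * 'I_a.+1}|)%N.
  rewrite card_sum !card_prod !card_ord.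
  by move: big; move: (a) (e) => x y; lia.
have [R [pR [w Rw] R0]] := algebraic_dependence small pPhi.
pose R1 (v : targets a s m.+1 -> K) := R (fun ij => v (ij.1, inl ij.2)).
have pR1 : polyfun R1.
  by apply: (polyfun_comp (g := fun ij v => v (ij.1, inl ij.2)) pR) => ij; apply: PolyVar.
have [|c [b0 l0]] := hp R1 pR1.
  exists (fun z => if z.2 is inl j then w (z.1, j) else 0).
  by rewrite /R1 (polyfun_eq pR (w := w)) // => -[].
have [x ex] := interp_data_normalize (fun i => pcoord (p i) 0) (b0 ord0) (l0 ord0).
rewrite -(polyfun_eq pR1 ex) /R1.
rewrite (polyfun_eq pR (w := Phi^~ (fun c => match c with
   | inl jl => x (inl jl) | inr i => x (inr (inr (inr (inl i)))) end))) ?R0 ?eqxx //.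
Qed.

End Bounds.

Theorem corollary7p0p3 (K : closedFieldType) (r s d k : nat)
    (hs : s.+2 <= r) (hk : k < d) :
  is_largest (fun n => interpolation K r s d k n)
    (minn (((r - s) * (d - k)) %/ (r - s - 1))
          ((r.+1 * d - (r - s - 1) * k) %/ r)).+1.
Proof.
have a0 : 0 < r - s - 1 by lia.
have r0 : 0 < r by lia.
have rE : r - s = (r - s - 1).+1 by lia.
set N := minn _ _.
(* With [m + 1] points, the two floors translate into the two inequalities of the counts. The
   subtraction in the second is not truncated, because [k < d]. *)
have bound m : (m <= N) =
   ((r - s - 1) * m <= (r - s - 1).+1 * (d - k)) &&
   ((r - s - 1 + s.+1) * m + (r - s - 1) * k <= (r - s - 1 + s.+2) * d).
  rewrite leq_min !leq_divRL // -rE ![m * _]mulnC; congr (_ && _).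
  have -> : r - s - 1 + s.+1 = r by lia.
  have -> : r - s - 1 + s.+2 = r.+1 by lia.
  rewrite leq_subRL; first by rewrite addnC.
  by rewrite leq_mul //; lia.
split.
  by have := leqnn N; rewrite bound => /andP[]; apply: interpolation_exists.
case=> [//|m] hm; rewrite ltnS bound.
by rewrite (interpolation_bound_base hs hk hm) (interpolation_bound_total hs hk hm).
Qed.
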